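(* Let $(X,\mathcal{A},\mu,T)$ be an ergodic probability preserving system, $Y\in\mathcal{A}$ (with $\mu(Y)>0$), $(A_l)$ an asymptotically rare sequence in $\mathcal{A}\cap Y$, and $(\psi_{A_l})_{l\ge1}$ a sequence of $\mathfrak{F}$-valued local observables for the $A_l$ with corresponding local processes $\Psi_{A_l}$. Let $(\Phi,\Psi)$ be a random element of $[0,\infty)^{\mathbb{N}}\times\mathfrak{F}^{\mathbb{N}}$. Then, as $l\to\infty$, $$(\mu(A_l)\Phi_{A_l},\Psi_{A_l})\overset{\mu}{\Longrightarrow}(\Phi,\Psi)\quad\text{iff}\quad(\mu_Y(A_l)\Phi^Y_{A_l},\Psi_{A_l})\overset{\mu_Y}{\Longrightarrow}(\Phi,\Psi).$$
   Context: $(\mathfrak{F},d_{\mathfrak{F}})$ compact metric space. For $A$ with $\mu(A)>0$: $\varphi_A(x):=\inf\{n\ge1:T^nx\in A\}$, $T_Ax:=T^{\varphi_A(x)}x$, $\mu_A:=\mu(A\cap\cdot)/\mu(A)$, $\Phi_A:=(\varphi_A,\varphi_A\circ T_A,\ldots)$. $T_Y:Y\to Y$ is the first-return map of $Y$; for $A\subseteq Y$, $\varphi^Y_A(x):=\inf\{j\ge1:T_Y^jx\in A\}$ ($x\in Y$) and $\Phi^Y_A:=(\varphi^Y_A,\varphi^Y_A\circ T_A,\varphi^Y_A\circ T_A^2,\ldots)$ on $Y$. Local observable: measurable $\psi_A:A\to\mathfrak{F}$; $\Psi_A:=(\psi_A\circ T_A,\psi_A\circ T_A^2,\ldots)$.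 Asymptotically rare: $0<\mu(A_l)\to0$. $[0,\infty]$ is metrized by $|e^{-s}-e^{-t}|$ and sequence spaces carry product metrics; $\overset{\nu}{\Longrightarrow}$: weak convergence of laws under $\nu$. *)

(* Defs.v *)
From HB Require Import structures.
From mathcomp Require Import all_boot all_order all_algebra.
From mathcomp Require Import all_classical all_reals all_analysis.
Set Implicit Arguments. Unset Strict Implicit. Unset Printing Implicit Defensive.
Import Order.TTheory GRing.Theory Num.Theory.
Import numFieldNormedType.Exports.
Local Open Scope classical_set_scope.
Local Open Scope ring_scope.

Section Defs.
Context {d : measure_display} {X : measurableType d} {R : realType}.

Definition hits (T : X -> X) (A : set X) (x : X) : Prop :=
  exists n, (0 < n)%N /\ A (iter n T x).

(** first (positive) hitting time as a natural number; 0 if [A] is never hit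
    (this convention only matters on a null set). *)
Definition hitn (T : X -> X) (A : set X) (x : X) : nat :=
  xget 0%N [set n | (0 < n)%N /\ A (iter n T x) /\
                    forall m, (0 < m)%N -> A (iter m T x) -> (n <= m)%N].

(** phi_A(x) = inf {n >= 1 : T^n x \in A}, in [0, +oo] (inf of empty = +oo). *)
Definition phi (T : X -> X) (A : set X) (x : X) : \bar R :=
  ereal_inf [set ((n%:R : R)%:E) | n in [set n | (0 < n)%N /\ A (iter n T x)]].

Definition firstret (T : X -> X) (A : set X) (x : X) : X :=
  iter (hitn T A x) T x.

(** Phi_A = (phi_A, phi_A o T_A, phi_A o T_A^2, ...), with the hitting
    function [h] (phi_A, or phi^Y_A for the induced version). *)
Definition Phiseq (h : X -> \bar R) (T : X -> X) (A : set X) (x : X)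
  : nat -> \bar R := fun n => h (iter n (firstret T A) x).

Definition Psiseq {F : Type} (psi : X -> F) (T : X -> X) (A : set X) (x : X)
  : nat -> F := fun n => psi (iter n.+1 (firstret T A) x).

Definition measure_preserving (mu : {measure set X -> \bar R}) (T : X -> X) :=
  measurable_fun setT T /\
  forall B, measurable B -> mu (T @^-1` B) = mu B.

Definition ergodic (mu : {measure set X -> \bar R}) (T : X -> X) :=
  forall B, measurable B -> T @^-1` B = B -> mu B = 0%E \/ mu B = 1%E.

Definition borel_measurable_on {F : topologicalType} (D : set X) (f : X -> F) :=
  measurable D /\ forall U : set F, open U -> measurable (D `&` f @^-1` U).

End Defs.

Definition mean_on {d} {X : measurableType d} {R : realType}
  (mu : {measure set X -> \bar R}) (D : set X) (g : X -> R) : R :=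
  (fine (mu D))^-1 * Rintegral mu D g.

(** State space [0,oo]^N x F^N (product topologies); [0,oo] sits in \bar R. *)
Definition Espace (R : realType) (F : topologicalType) : topologicalType :=
  ({ptws nat -> \bar R} * {ptws nat -> F})%type.

Definition cvg_law {R : realType} {E : topologicalType}
  {d} {X : measurableType d} (mu : {measure set X -> \bar R}) (D : set X)
  (Z : nat -> X -> E)
  {dO} {Om : measurableType dO} (P : probability Om R) (Zinf : Om -> E) :=
  forall f : E -> R, continuous f -> (exists M : R, forall e, `|f e| <= M) ->
    (fun l => mean_on mu D (f \o Z l)) @ \oo --> mean_on P setT (f \o Zinf).

(* Main.v *)
Require Import Defs.
From HB Require Import structures.
From mathcomp Require Import all_boot all_order all_algebra.
From mathcomp Require Import all_classical all_reals all_analysis.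
From mathcomp Require Import measurable_realfun ring lra.
Import Order.TTheory GRing.Theory Num.Theory.
Import numFieldNormedType.Exports.
Local Open Scope classical_set_scope.
Local Open Scope ring_scope.

(** Write [m = mu(Y)] and [S_n(x) = #{1 <= i <= n : T^i x \in Y}]. Almost every
    point returns to [A_l] infinitely often, and for such a point [phi^Y_A] is
    [S_n] at time [n = phi_A]. Hence the partial sums of [Phi_A] and [Phi^Y_A] at
    [x] are [t] and [S_t(x)] for the same hitting time [t], and Birkhoff's
    theorem for the indicator of [Y] makes [mu(A_l) t] and
    [mu_Y(A_l) S_t = mu(A_l) S_t / m] asymptotically equal as soon as
    [mu(A_l) t] is tight. This is where finiteness of the limit [Phi] enters.
    So both processes have the same limits in law under [mu_Y].

    To pass from [mu_Y] to [mu] for [(mu(A_l) Phi, Psi)], note that applying [T]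
    changes only the first return time, by [mu(A_l)], off the small set
    [T^-1 A_l]. A test function of the process is therefore almost [T]-invariant,
    so its integral against [1_Y] is close to the one against the ergodic averages
    of [1_Y], which are close to [m]. *)

Set Implicit Arguments.
Unset Strict Implicit.

(** * Expectations of bounded measurable functions under a probability measure *)

Section bounded_measurable.
Context {R : realType} {d : measure_display} {X : measurableType d}.
Implicit Types (g h : X -> R) (B D : set X).

(** Such functions are integrable for a probability measure and stable under all the operations used
    below, so the side conditions of integral identities reduce to membership in this class. *)
Definition bmf g :=
  measurable_fun setT g /\ exists M : R, forall x, `|g x| <= M.

Lemma bmf_cst (r : R) : bmf (fun=> r).
Proof. by split; [exact: measurable_cst | exists `|r|]. Qed.

Lemma bmfN g : bmf g -> bmf (fun x => - g x).
Proof.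
move=> [mg [M gM]]; split; first exact: measurableT_comp.
by exists M => x; rewrite normrN.
Qed.

Lemma bmfD g h : bmf g -> bmf h -> bmf (fun x => g x + h x).
Proof.
move=> [mg [M gM]] [mh [N hN]]; split; first exact: measurable_funD.
by exists (M + N) => x; rewrite (le_trans (ler_normD _ _))// lerD.
Qed.

Lemma bmfB g h : bmf g -> bmf h -> bmf (fun x => g x - h x).
Proof. by move=> bg bh; apply: bmfD => //; exact: bmfN. Qed.

Lemma bmfM g h : bmf g -> bmf h -> bmf (fun x => g x * h x).
Proof.
move=> [mg [M gM]] [mh [N hN]]; split; first exact: measurable_funM.
by exists (M * N) => x; rewrite normrM ler_pM.
Qed.

Lemma bmf_norm g : bmf g -> bmf (fun x => `|g x|).
Proof.
move=> [mg [M gM]]; split; first exact: measurableT_comp.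
by exists M => x; rewrite normr_id.
Qed.

Lemma bmf_max0 g : bmf g -> bmf (fun x => Num.max 0 (g x)).
Proof.
move=> [mg [M gM]]; split.
  by apply: measurable_maxr => //; exact: measurable_cst.
exists M => x; apply: le_trans (gM x).
by case: (leP 0 (g x)) => // _; rewrite normr0.
Qed.

Lemma bmf_indic B : measurable B -> bmf (\1_B : X -> R).
Proof.
move=> mB; split; first exact: measurable_indic.
by exists 1 => x; rewrite indicE normr_nat lern1 leq_b1.
Qed.

Lemma bmf_sum n (g : nat -> X -> R) : (forall i, bmf (g i)) ->
  bmf (fun x => \sum_(i < n) g i x).
Proof.
move=> bg; elim: n => [|n IH].
  by under eq_fun do rewrite big_ord0; exact: bmf_cst.
by under eq_fun do rewrite big_ord_recr/=; exact: bmfD.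
Qed.

Lemma bmf_comp (T : X -> X) g : measurable_fun setT T -> bmf g -> bmf (g \o T).
Proof.
move=> mT [mg [M gM]]; split; first exact: measurableT_comp.
by exists M => x /=.
Qed.

Variable mu : probability X R.
Local Notation E := (Rintegral mu setT).

Lemma bmf_integrable g : bmf g -> mu.-integrable setT (EFin \o g).
Proof.
move=> [mg [M gM]]; apply: measurable_bounded_integrable => //.
  by rewrite (le_lt_trans (probability_le1 mu measurableT))// ltry.
exists M; split; first exact: num_real.
by move=> x Mx y _ /=; rewrite (le_trans (gM y))// ltW.
Qed.

Lemma expD g h : bmf g -> bmf h -> E (fun x => g x + h x) = E g + E h.
Proof. by move=> bg bh; rewrite RintegralD//; exact: bmf_integrable. Qed.

Lemma expB g h : bmf g -> bmf h -> E (fun x => g x - h x) = E g - E h.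
Proof. by move=> bg bh; rewrite RintegralB//; exact: bmf_integrable. Qed.

Lemma expZ (r : R) g : bmf g -> E (fun x => r * g x) = r * E g.
Proof. by move=> bg; rewrite RintegralZl//; exact: bmf_integrable. Qed.

Lemma exp_le g h : bmf g -> bmf h -> (forall x, g x <= h x) -> E g <= E h.
Proof.
by move=> bg bh gh; apply: le_Rintegral => //; exact: bmf_integrable.
Qed.

Lemma exp_cst (r : R) : E (fun=> r) = r.
Proof.
rewrite Rintegral_cst// -[RHS]mulr1; congr (_ * _).
by rewrite -[1]/(fine 1%:E) -(probability_setT mu).
Qed.

Lemma exp_indic B : measurable B -> E (\1_B) = fine (mu B).
Proof. by move=> mB; rewrite /Rintegral integral_indic// setIT. Qed.

Lemma exp_norm g : bmf g -> `|E g| <= E (fun x => `|g x|).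
Proof. by move=> bg; apply: le_normr_Rintegral => //; exact: bmf_integrable. Qed.

Lemma exp_sum n (g : nat -> X -> R) : (forall i, bmf (g i)) ->
  E (fun x => \sum_(i < n) g i x) = \sum_(i < n) E (g i).
Proof.
move=> bg; elim: n => [|n IH].
  by under eq_fun do rewrite big_ord0; rewrite exp_cst big_ord0.
under eq_fun do rewrite big_ord_recr/=.
by rewrite expD//; [rewrite IH big_ord_recr | exact: bmf_sum].
Qed.

Lemma exp_setI D g : E (fun x => g x * \1_D x) = Rintegral mu D g.
Proof.
rewrite [RHS]Rintegral_mkcond; apply: eq_Rintegral => x _.
by rewrite patchE indicE; case: ifP; rewrite ?mulr1 ?mulr0.
Qed.

Lemma exp_preserving (T : X -> X) g : measure_preserving mu T -> bmf g ->
  E (g \o T) = E g.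
Proof.
move=> [mT muT] bg; rewrite /Rintegral; congr fine.
rewrite -[LHS](@integral_pushforward _ _ _ _ _ T mT mu setT (EFin \o g))//.
- by apply: eq_measure_integral => B mB _; exact: muT.
- apply/measurable_EFinP; exact: bg.1.
- by have := bmf_integrable (bmf_comp mT bg); rewrite compA.
Qed.

Import HBNNSimple.

(* No measurability of [f] is assumed: the simple functions below [f] may be
   cut off on the complement of [D]. *)
Lemma ge0_integral_setI_full B D (f : X -> \bar R) :
  measurable D -> mu D = 1%E -> (forall x, 0 <= f x)%E ->
  (\int[mu]_(x in B `&` D) f x = \int[mu]_(x in B) f x)%E.
Proof.
move=> mD muD f0.
rewrite integral_mkcond [RHS]integral_mkcond.
have p0 (C : set X) x : (0 <= (f \_ C) x)%E by rewrite patchE; case: ifP.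
rewrite ge0_integralTE; last exact: p0.
rewrite [RHS]ge0_integralTE; last exact: p0.
apply/eqP; rewrite eq_le; apply/andP; split.
  apply: ge_ereal_sup => _ [h /= hf <-]; apply: ereal_sup_ubound.
  exists h => // x; apply: le_trans (hf x) _; rewrite !patchE in_setI.
  by case: (x \in B) => //=; case: ifP.
apply: ge_ereal_sup => _ [h /= hf <-]; apply: ereal_sup_ubound.
exists (proj_nnsfun h mD) => /=.
  move=> x; rewrite !patchE in_setI mindicE; have := hf x; rewrite !patchE.
  by case: (x \in B); case: (x \in D); rewrite //= ?mulr1 ?mulr0.
rewrite -!integralT_nnsfun.
rewrite [RHS](@ge0_negligible_integral _ _ _ mu setT (~` D))//.
- rewrite setDE setCK setTI [RHS]integral_mkcond; apply: eq_integral => x _.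
  by rewrite /= patchE mindicE; case: ifP; rewrite ?mulr1 ?mulr0.
- exact: measurableC.
- by apply/measurable_EFinP.
- by move=> x _; rewrite lee_fin.
- by have : mu (~` D) = 0%E by rewrite probability_setC// muD subee.
Qed.

(** Serves to integrate a test function of a return process over the recurrent points only, since
    its measurability is under control only there. *)
Lemma Rintegral_setI_full B D (g : X -> R) : measurable D -> mu D = 1%E ->
  Rintegral mu (B `&` D) g = Rintegral mu B g.
Proof.
move=> mD muD; rewrite /Rintegral; congr fine.
by rewrite integralE [RHS]integralE !ge0_integral_setI_full.
Qed.

End bounded_measurable.

(** * Real-valued probabilities and continuity from above *)

Section probability_real.
Context {R : realType} {d : measure_display} {X : measurableType d}.
Variable mu : probability X R.
Implicit Types (B C : set X) (g : X -> R).

Definition Pr B : R := fine (mu B).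

Lemma Pr_exp B : measurable B -> Pr B = Rintegral mu setT (\1_B).
Proof. by move=> mB; rewrite exp_indic. Qed.

Lemma PrE B : measurable B -> mu B = (Pr B)%:E.
Proof. by move=> mB; rewrite fineK//; exact: fin_num_measure. Qed.

Lemma Pr_ge0 B : 0 <= Pr B.
Proof. exact/fine_ge0/measure_ge0. Qed.

Lemma Pr_le B C : measurable B -> measurable C -> B `<=` C -> Pr B <= Pr C.
Proof.
move=> mB mC BC; rewrite !Pr_exp//; apply: exp_le; try exact: bmf_indic.
move=> x; rewrite !indicE ler_nat.
by have [xB|] := boolP (x \in B) => //; rewrite (mem_set (BC _ (set_mem xB))).
Qed.

Lemma PrU B C : measurable B -> measurable C -> Pr (B `|` C) <= Pr B + Pr C.
Proof.
move=> mB mC; rewrite !Pr_exp//; last exact: measurableU.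
rewrite -expD; try exact: bmf_indic.
apply: exp_le; [by apply/bmf_indic/measurableU | by apply/bmfD; exact: bmf_indic|].
move=> x; rewrite !indicE -natrD ler_nat in_setU.
by case: (x \in B); case: (x \in C).
Qed.

Lemma PrC B : measurable B -> Pr (~` B) = 1 - Pr B.
Proof.
move=> mB; rewrite !Pr_exp//; last exact: measurableC.
rewrite -[X in X - _](exp_cst mu) -expB; [|exact: bmf_cst|exact: bmf_indic].
apply: eq_Rintegral => x _; rewrite !indicE in_setC.
by case: (x \in B); rewrite ?subrr ?subr0.
Qed.

(** Continuity from above, in the quantitative form that supplies the thresholds [K], [N] and [j] of
    later proofs. *)
Lemma Pr_nonincreasing_small (B : nat -> set X) (e : R) :
  (forall n, measurable (B n)) -> (forall n, B n.+1 `<=` B n) ->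
  Pr (\bigcap_n B n) = 0 -> 0 < e -> exists n, Pr (B n) <= e.
Proof.
move=> mB decB cap0 e0.
have mcap : measurable (\bigcap_n B n) by exact: bigcapT_measurable.
have : mu \o B @ \oo --> mu (\bigcap_n B n).
  apply: nonincreasing_cvg_mu => //.
    by rewrite (le_lt_trans (probability_le1 mu (mB 0%N)))// ltry.
  by apply/nonincreasing_seqP => n; apply/subsetPset.
rewrite (PrE mcap) cap0 => /fine_cvgP[_ /cvgrPdist_le/(_ e e0)[n _ /(_ n (leqnn n))]] /=.
by rewrite sub0r normrN ger0_norm ?Pr_ge0// => ?; exists n.
Qed.

Lemma measurable_gt g (r : R) : measurable_fun setT g ->
  measurable [set x | r < g x].
Proof.
move=> mg; rewrite -[X in measurable X]setTI.
rewrite (_ : [set x | r < g x] = g @^-1` `]r, +oo[%classic); first exact: mg.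
by apply/seteqP; split=> x /=; rewrite in_itv/= andbT.
Qed.

End probability_real.

Lemma measurable_iter {d : measure_display} {X : measurableType d} (T : X -> X) n :
  measurable_fun setT T -> measurable_fun setT (iter n T).
Proof.
move=> mT; elim: n => [|n IH]; first exact: measurable_id.
by rewrite (_ : iter n.+1 T = T \o iter n T)//; exact: measurableT_comp.
Qed.

Lemma measurable_preimage_iter {d : measure_display} {X : measurableType d}
    (T : X -> X) n (A : set X) :
  measurable_fun setT T -> measurable A -> measurable (iter n T @^-1` A).
Proof.
by move=> mT mA; rewrite -[X in measurable X]setTI; exact: measurable_iter.
Qed.

(** * Maximal ergodic inequality, visit frequencies and recurrence *)

Section birkhoff.
Context {R : realType} {d : measure_display} {X : measurableType d}.
Variables (mu : probability X R) (T : X -> X).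
Hypotheses (muT : measure_preserving mu T) (ergT : ergodic mu T).
Let mT : measurable_fun setT T := muT.1.
Local Notation E := (Rintegral mu setT).

Lemma Pr_preimage_iter n (B : set X) : measurable B ->
  Pr mu (iter n T @^-1` B) = Pr mu B.
Proof.
move=> mB; elim: n => // n IH.
rewrite (_ : _ @^-1` _ = T @^-1` (iter n T @^-1` B)); last first.
  by apply/seteqP; split => x /=; rewrite -iterSr.
rewrite -IH; congr fine; apply: muT.2.
exact: measurable_preimage_iter.
Qed.

Definition bsum (u : X -> R) n x := \sum_(i < n) u (iter i T x).

Lemma bsumS u n x : bsum u n.+1 x = u x + bsum u n (T x).
Proof.
by rewrite /bsum big_ord_recl/=; congr (_ + _); apply: eq_bigr => i _; rewrite -iterSr.
Qed.

(* [maxsum u N x] is the maximum of [bsum u n x] over [n <= N]. *)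
Fixpoint maxsum (u : X -> R) N x : R :=
  if N is N'.+1 then Num.max 0 (u x + maxsum u N' (T x)) else 0.

Lemma maxsum_ge0 u N x : 0 <= maxsum u N x.
Proof. by case: N => //= N; rewrite le_max lexx. Qed.

Lemma maxsum_incr u N x : maxsum u N x <= maxsum u N.+1 x.
Proof.
elim: N x => [|N IH] x; first exact: maxsum_ge0.
rewrite [leLHS]/= [leRHS]/= ge_max le_max lexx/= le_max; apply/orP; right.
by rewrite lerD2l; exact: IH.
Qed.

Lemma bsum_le_maxsum u n N x : (n <= N)%N -> bsum u n x <= maxsum u N x.
Proof.
elim: N n x => [|N IH] [|n] x //; rewrite ?/bsum ?big_ord0 ?maxsum_ge0// => nN.
by rewrite -/(bsum u n.+1 x) bsumS /= le_max lerD2l IH ?orbT.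
Qed.

Lemma bmf_maxsum u N : bmf u -> bmf (maxsum u N).
Proof.
move=> bu; elim: N => [|N IH]; first exact: bmf_cst.
by apply: bmf_max0; apply: bmfD => //; exact: bmf_comp.
Qed.

Lemma bmf_bsum u n : bmf u -> bmf (bsum u n).
Proof.
move=> bu; apply: (@bmf_sum _ _ _ n (fun i => u \o iter i T)) => i.
by apply: bmf_comp => //; exact: measurable_iter.
Qed.

(* Garsia's argument: where the maximum is positive, it is attained at a
   nonempty sum, so that [maxsum u N x <= u x + maxsum u N (T x)]. *)
Lemma maximal_ergodic u N : bmf u ->
  0 <= E (fun x => u x * \1_[set x | 0 < maxsum u N x] x).
Proof.
move=> bu; have bM := bmf_maxsum N bu.
have mP : measurable [set x | 0 < maxsum u N x] by apply: measurable_gt; exact: bM.1.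
have bMT : bmf (maxsum u N \o T) by exact: bmf_comp.
have {1}<- : E (fun x => maxsum u N x - (maxsum u N \o T) x) = 0.
  by rewrite expB// exp_preserving// subrr.
apply: exp_le; first exact: bmfB.
  exact: (bmfM bu (bmf_indic mP)).
move=> x; rewrite indicE.
case: (boolP (x \in [set x | 0 < maxsum u N x])); last first.
  rewrite notin_setE /= => /negP; rewrite -leNgt => M0.
  by rewrite mulr0 subr_le0 (le_trans M0)// maxsum_ge0.
rewrite inE /= mulr1 lerBlDr; case: N {bM mP bMT} => [|N]; first by rewrite ltxx.
move=> Mp; rewrite /= in Mp *.
have -> : Num.max 0 (u x + maxsum u N (T x)) = u x + maxsum u N (T x).
  by move: Mp; rewrite lt_max ltxx/= => Mp; rewrite max_r// ltW.
by rewrite lerD2l; exact: maxsum_incr.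
Qed.

Lemma measurable_bsum_gt u (K : nat) : bmf u ->
  measurable [set x | exists n, K%:R < bsum u n x].
Proof.
move=> bu.
rewrite (_ : mkset _ = \bigcup_n [set x | K%:R < bsum u n x]); last first.
  by apply/seteqP; split => x [n]; [exists n | move=> _ ?; exists n].
by apply: bigcupT_measurable => n; apply: measurable_gt; exact: (bmf_bsum n bu).1.
Qed.

(** One-sided Birkhoff theorem. The points with sums unbounded above form an invariant set [D]. If
    [D] is null, continuity from above gives [K]. If [D] has full measure, the maximal sum is
    eventually positive almost everywhere, and the maximal inequality contradicts [E u < 0]. *)
Lemma bsum_bounded_above u (e : R) : bmf u -> E u < 0 -> 0 < e ->
  exists K : nat, Pr mu [set x | exists n, K%:R < bsum u n x] <= e.
Proof.
move=> bu Eu0 e0; have [_ [M' uM']] := bu.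
have [M M0 uM] : exists2 M, 0 <= M & forall x, `|u x| <= M.
  by exists `|M'| => // x; rewrite (le_trans (uM' x))// ler_norm.
pose B (K : nat) := [set x | exists n, K%:R < bsum u n x].
have mB K : measurable (B K) by exact: measurable_bsum_gt.
have decB K : B K.+1 `<=` B K.
  by move=> x [n Kn]; exists n; rewrite (lt_trans _ Kn)// ltr_nat.
pose D := \bigcap_K B K.
have mD : measurable D by exact: bigcapT_measurable.
(* Replacing [x] by [T x] drops the term [u x], which is at most [M] in absolute value; this does
   not affect unboundedness. *)
have invD : T @^-1` D = D.
  apply/seteqP; split => x Dx K _.
    have [N KN] : exists N : nat, K%:R + M <= N%:R.
      by exists (Num.bound (K%:R + M)); rewrite ltW// archi_boundP// addr_ge0.
    have [n Nn] := Dx N I; exists n.+1; rewrite bsumS.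
    have := uM x; rewrite ler_norml => /andP[+ _]; move: KN Nn; lra.
  have [N KN] : exists N : nat, K%:R + M <= N%:R.
    by exists (Num.bound (K%:R + M)); rewrite ltW// archi_boundP// addr_ge0.
  have [[|n] Nn] := Dx N I.
    move: Nn; rewrite /bsum big_ord0 => N0.
    by have := ler0n R N; rewrite leNgt N0.
  exists n; move: Nn; rewrite bsumS.
  have := uM x; rewrite ler_norml => /andP[_ +]; move: KN; lra.
have [D0|D1] := ergT mD invD.
  by apply: (Pr_nonincreasing_small mB decB) => //; rewrite /Pr D0.
pose P N := [set x | 0 < maxsum u N x].
have mP N : measurable (P N) by apply: measurable_gt; exact: (bmf_maxsum N bu).1.
have mPC N : measurable (~` P N) by exact: measurableC.
have decP N : ~` P N.+1 `<=` ~` P N.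
  by apply: subsetC => x; rewrite /P /= => /lt_le_trans; apply; exact: maxsum_incr.
have capP : Pr mu (\bigcap_N ~` P N) = 0.
  apply/eqP; rewrite eq_le Pr_ge0 andbT.
  have -> : 0 = Pr mu (~` D) by rewrite PrC// /Pr D1 subrr.
  apply: Pr_le; [exact: bigcapT_measurable|exact: measurableC|].
  move=> x xP Dx; have [n xn] := Dx 0%N I; apply: (xP n I).
  exact: lt_le_trans xn (bsum_le_maxsum _ _ (leqnn n)).
(* With the complement of [P N] of measure at most [- E u / (M + 1) / 2], the lower bound on [E u]
   below becomes [E u / 2], which is absurd for negative [E u]. The [+ 1] covers [M = 0]. *)
have e'0 : 0 < - E u / (M + 1) by rewrite divr_gt0 ?oppr_gt0// ltr_wpDl.
have e'0' : 0 < - E u / (M + 1) / 2 by rewrite divr_gt0.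
have [N PN] := Pr_nonincreasing_small mPC decP capP e'0'.
(* Split over [P N] and its complement: the maximal inequality makes the first part nonnegative, and
   [u >= - M] bounds the second. *)
have : E u >= - M * Pr mu (~` P N).
  have bP := bmf_indic (R := R) (mP N).
  have bPC := bmf_indic (R := R) (mPC N).
  rewrite (_ : E u = E (fun x => u x * \1_(P N) x) +
      E (fun x => u x * \1_(~` P N) x)); last first.
    rewrite -expD; [|exact: bmfM|exact: bmfM].
    apply: eq_Rintegral => x _; rewrite !indicE in_setC.
    by case: (x \in P N); rewrite /= ?mulr0 ?mulr1 ?addr0 ?add0r.
  rewrite -[leLHS]add0r lerD ?maximal_ergodic// Pr_exp// -expZ//.
  apply: exp_le; [exact: bmfM (bmf_cst _) _|exact: bmfM|].
  move=> x; rewrite ler_wpM2r//.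
  have := uM x; by rewrite ler_norml => /andP[].
have h1 : M * Pr mu (~` P N) <= (M + 1) * (- E u / (M + 1) / 2).
  by apply: ler_pM => //; [exact: Pr_ge0| rewrite lerDl].
have h2 : (M + 1) * (- E u / (M + 1) / 2) = - E u / 2.
  by field; rewrite gt_eqF// ltr_wpDl.
move: h1 Eu0; rewrite h2 mulNr; lra.
Qed.

(** This is [S_n(x)]. The counted times run from [1] to [n], in step with positive hitting times: a
    visit at time [n] counts, one at time [0] does not. *)
Definition visits (Y : set X) n x : nat := \sum_(i < n) (iter i.+1 T x \in Y).

Lemma visits_bsum Y n x (c : R) :
  (visits Y n x)%:R - c * n%:R = bsum (fun y => \1_Y (T y) - c) n x.
Proof.
rewrite /visits /bsum natr_sum; under [RHS]eq_bigr do rewrite indicE.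
by rewrite big_split/= sumr_const card_ord mulNrn mulr_natr.
Qed.

Lemma visits_bsumN Y n x (c : R) :
  c * n%:R - (visits Y n x)%:R = bsum (fun y => c - \1_Y (T y)) n x.
Proof.
rewrite -opprB visits_bsum /bsum -sumrN; apply: eq_bigr => i _.
by rewrite opprB.
Qed.

(** The functions [u1] and [u2] both have mean [- e], so their Birkhoff sums are bounded above off
    small sets, which gives the two sides of the estimate. The bound holds for all [n] at once, so
    it can be evaluated at a time depending on [x], such as a hitting time. *)
Lemma visits_ergodic (Y : set X) (e r : R) : measurable Y -> 0 < e -> 0 < r ->
  exists (C : nat) (B : set X), [/\ measurable B, Pr mu B <= r &
    forall x, ~ B x -> forall n,
      `|(visits Y n x)%:R - Pr mu Y * n%:R| <= e * n%:R + C%:R].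
Proof.
move=> mY e0 r0; set m := Pr mu Y.
have r20 : 0 < r / 2 by rewrite divr_gt0.
have bY : bmf (\1_Y \o T : X -> R) by apply: bmf_comp => //; exact: bmf_indic.
have EY : E (\1_Y \o T) = m by rewrite exp_preserving// ?exp_indic//; exact: bmf_indic.
pose u1 := (fun y => (\1_Y \o T) y - (m + e)) : X -> R.
pose u2 := (fun y => (m - e) - (\1_Y \o T) y) : X -> R.
have bu1 : bmf u1 by apply: bmfB => //; exact: bmf_cst.
have bu2 : bmf u2 by apply: bmfB => //; exact: bmf_cst.
have Eu1 : E u1 < 0 by rewrite expB ?exp_cst// ?EY; [lra|exact: bmf_cst].
have Eu2 : E u2 < 0 by rewrite expB ?exp_cst// ?EY; [lra|exact: bmf_cst].
have [K1 BK1] := bsum_bounded_above bu1 Eu1 r20.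
have [K2 BK2] := bsum_bounded_above bu2 Eu2 r20.
have m1 := measurable_bsum_gt K1 bu1; have m2 := measurable_bsum_gt K2 bu2.
exists (K1 + K2)%N; eexists; split.
- exact: measurableU m1 m2.
- by rewrite (le_trans (PrU _ _ _))//; lra.
move=> x Bx n; rewrite natrD.
have [{}m1 {}m2] : (visits Y n x)%:R - (m + e) * n%:R <= K1%:R /\
       (m - e) * n%:R - (visits Y n x)%:R <= K2%:R.
  split; rewrite leNgt; apply/negP => h; apply: Bx.
    by left; exists n; rewrite visits_bsum in h.
  by right; exists n; rewrite visits_bsumN in h.
have K10 := ler0n R K1; have K20 := ler0n R K2; have n0 := ler0n R n.
rewrite ler_norml; apply/andP; split; lra.
Qed.

(** Asking for infinitely many visits makes the set exactly equal to its preimage under [T], as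
    [ergodic] demands, and keeps the whole forward orbit inside it, so that return times can be
    iterated. *)
Definition recurrent (A : set X) : set X :=
  [set x | forall N, exists n, (N <= n)%N /\ A (iter n T x)].

Lemma recurrentE A : recurrent A = \bigcap_N \bigcup_n (iter (N + n) T @^-1` A).
Proof.
apply/seteqP; split => x Ax N.
  by move=> _; have [n [Nn An]] := Ax N; exists (n - N)%N => //; rewrite /= subnKC.
by have [n _ An] := Ax N I; exists (N + n)%N; rewrite leq_addr.
Qed.

Lemma recurrent_preimage A : T @^-1` recurrent A = recurrent A.
Proof.
apply/seteqP; split => x Ax N.
  by have [n [Nn An]] := Ax N; exists n.+1; split; [exact: leqW|rewrite iterSr].
have [n [Nn An]] := Ax N.+1; case: n Nn An => // n Nn An; exists n.
by split => //; rewrite -iterSr.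
Qed.

Lemma recurrent_iter A n x : recurrent A x -> recurrent A (iter n T x).
Proof.
move=> Ax; elim: n => // n; rewrite iterS.
by rewrite -{1}recurrent_preimage.
Qed.

Lemma measurable_recurrent A : measurable A -> measurable (recurrent A).
Proof.
move=> mA; rewrite recurrentE; apply: bigcapT_measurable => N.
by apply: bigcupT_measurable => n; exact: measurable_preimage_iter.
Qed.

(** By ergodicity the measure is [0] or [1]. The sets [B N] decrease to the recurrent set and each
    contains the preimage of [A] under [T^N], of measure [mu A > 0], which excludes [0]. *)
Lemma recurrent_full A : measurable A -> (0 < mu A)%E -> mu (recurrent A) = 1%E.
Proof.
move=> mA muA; have mrA := measurable_recurrent mA.
have [H0|//] := ergT mrA (recurrent_preimage A).
pose B N := \bigcup_n (iter (N + n) T @^-1` A).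
have mB N : measurable (B N).
  by apply: bigcupT_measurable => n; exact: measurable_preimage_iter.
have decB N : B N.+1 `<=` B N.
  by move=> x [n _ An]; exists n.+1 => //; rewrite addnS -addSn.
have PA0 : 0 < Pr mu A by rewrite -lte_fin -PrE.
have PA20 : 0 < Pr mu A / 2 by rewrite divr_gt0.
have cap0 : Pr mu (\bigcap_N B N) = 0 by rewrite -recurrentE /Pr H0.
have [N +] := Pr_nonincreasing_small mB decB cap0 PA20.
have : Pr mu A <= Pr mu (B N).
  rewrite -(Pr_preimage_iter N mA); apply: Pr_le => //.
    exact: measurable_preimage_iter.
  by move=> x Ax; exists 0%N => //; rewrite /= addn0.
move=> h1 h2; exfalso; move: PA0 h1 h2; clear; lra.
Qed.

End birkhoff.

(** * Combinatorics of hitting times, first-return maps and visit counts *)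

Section hitting.
Context {d : measure_display} {X : measurableType d}.
Implicit Types (T : X -> X) (A Y : set X).

Lemma measurable_countable_fibers (C : countType) (D : set X) (c : X -> C)
    (P : set C) :
  (forall v, measurable (D `&` [set x | c x = v])) -> measurable (D `&` c @^-1` P).
Proof.
move=> mc; pose F v := if v \in P then D `&` [set x | c x = v] else set0.
rewrite (_ : _ `&` _ = \bigcup_v F v); last first.
  apply/seteqP; split => x.
    by move=> [Dx Pcx]; exists (c x) => //; rewrite /F mem_set.
  move=> [v _]; rewrite /F; case: ifPn => // /set_mem Pv [Dx /= cx].
  by split=> //=; rewrite cx.
apply: countable_bigcupT_measurable => [|v]; first exact: countableP.
by rewrite /F; case: ifP.
Qed.

Lemma hitnP T A x : hits T A x ->
  [/\ (0 < hitn T A x)%N, A (iter (hitn T A x) T x) &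
      forall m, (0 < m)%N -> A (iter m T x) -> (hitn T A x <= m)%N].
Proof.
move=> [n [n0 An]].
have ex : exists n, (0 < n)%N && (iter n T x \in A).
  by exists n; rewrite n0 mem_set.
have : exists n, (0 < n)%N /\ A (iter n T x) /\
    forall m, (0 < m)%N -> A (iter m T x) -> (n <= m)%N.
  case: (ex_minnP ex) => m /andP[m0 /set_mem Am] mmin; exists m; split=> //.
  by split=> // k k0 Ak; apply: mmin; rewrite k0 mem_set.
by move=> /(xgetPex 0%N) [? []].
Qed.

Lemma hitn_unique T A x n : (0 < n)%N -> A (iter n T x) ->
  (forall m, (0 < m)%N -> A (iter m T x) -> (n <= m)%N) -> hitn T A x = n.
Proof.
move=> n0 An nmin; have [h0 Ah hmin] : [/\ (0 < hitn T A x)%N, A (iter (hitn T A x) T x) &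
      forall m, (0 < m)%N -> A (iter m T x) -> (hitn T A x <= m)%N].
  by apply: hitnP; exists n.
by apply/eqP; rewrite eqn_leq hmin//= nmin.
Qed.

Lemma hitn_never T A x : ~ hits T A x -> hitn T A x = 0%N.
Proof. by move=> nh; apply: xgetPN => n [n0 [An _]]; apply: nh; exists n. Qed.

Lemma phi_hitn {R : realType} T A x : hits T A x ->
  phi T A x = ((hitn T A x)%:R : R)%:E.
Proof.
move=> /hitnP [h0 Ah hmin]; apply/eqP; rewrite eq_le; apply/andP; split.
  by apply: ereal_inf_lbound; exists (hitn T A x).
apply: le_ereal_inf_tmp => _ [n [n0 An] <-].
by rewrite lee_fin ler_nat; exact: hmin.
Qed.

Lemma measurable_hitn T A n : measurable_fun setT T -> measurable A ->
  measurable [set x | hitn T A x = n].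
Proof.
move=> mT mA; have mI k : measurable (iter k T @^-1` A).
  exact: measurable_preimage_iter.
case: n => [|n].
  rewrite (_ : mkset _ = ~` \bigcup_n (iter n.+1 T @^-1` A)).
    by apply: measurableC; exact: bigcupT_measurable.
  apply/seteqP; split => x /=.
    move=> h0 [k _ Ak]; have [] := @hitnP T A x; first by exists k.+1.
    by rewrite h0.
  by move=> nA; apply: hitn_never => -[[|k] [//= k0 Ak]]; apply: nA; exists k.
rewrite (_ : mkset _ = iter n.+1 T @^-1` A `&`
    \bigcap_(m in `I_n) (~` (iter m.+1 T @^-1` A))); last first.
  apply/seteqP; split => x /=.
    move=> hn; have hA : hits T A x by apply: contrapT => /hitn_never; rewrite hn.
    have [h0 Ah hmin] := hitnP hA; rewrite hn in Ah hmin; split=> // m /= mn Am.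
    by have := hmin m.+1 isT Am; rewrite ltnS leqNgt mn.
  move=> [An nA]; apply: hitn_unique => // -[//|m] _ Am.
  by rewrite ltnS leqNgt; apply/negP => mn; exact: (nA m mn).
apply: measurableI => //; apply: bigcap_measurableType => // k _.
exact: measurableC.
Qed.

Lemma measurable_firstret T A : measurable_fun setT T -> measurable A ->
  measurable_fun setT (firstret T A).
Proof.
move=> mT mA _ B mB; rewrite setTI.
rewrite (_ : _ @^-1` _ =
    \bigcup_n ([set x | hitn T A x = n] `&` iter n T @^-1` B)); last first.
  apply/seteqP; split => x /=; first by move=> Bx; exists (hitn T A x).
  by move=> [n _ [/= <-]].
apply: bigcupT_measurable => n; apply: measurableI; first exact: measurable_hitn.
exact: measurable_preimage_iter.
Qed.

Lemma recurrent_hits T A x : recurrent T A x -> hits T A x.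
Proof. by move=> /(_ 1%N) [n [n0 An]]; exists n. Qed.

(** For a recurrent point this is the time of the [k]-th visit to [A], that is, the hitting time [t]
    at which the partial sums of both processes are compared. *)
Definition hsum T A k x := \sum_(j < k) hitn T A (iter j (firstret T A) x).

Lemma iter_firstret T A k x : iter k (firstret T A) x = iter (hsum T A k x) T x.
Proof.
elim: k => [|k IH]; first by rewrite /hsum big_ord0.
by rewrite iterS IH {1}/firstret /hsum big_ord_recr/= -iterD addnC IH.
Qed.

Lemma recurrent_firstret T A k x :
  recurrent T A x -> recurrent T A (iter k (firstret T A) x).
Proof. by rewrite iter_firstret; exact: recurrent_iter. Qed.

Lemma mem_firstret T A k x :
  recurrent T A x -> A (iter k.+1 (firstret T A) x).
Proof.
move=> rx; rewrite iterS; have /recurrent_hits/hitnP[] // := recurrent_firstret k rx.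
Qed.

Lemma visitsD T Y a b x :
  visits T Y (a + b) x = (visits T Y a x + visits T Y b (iter a T x))%N.
Proof.
rewrite /visits big_split_ord/=; congr addn; apply: eq_bigr => i _.
by rewrite -iterS -[RHS]/(nat_of_bool (iter i.+1 T _ \in _)) -iterD addSn addnC.
Qed.

Lemma visits_leq T Y a b x : (a <= b)%N -> (visits T Y a x <= visits T Y b x)%N.
Proof. by move=> /subnKC <-; rewrite visitsD leq_addr. Qed.

Lemma visits_hitn T Y x : hits T Y x -> visits T Y (hitn T Y x) x = 1%N.
Proof.
move=> /hitnP; case: (hitn T Y x) => [[//]|n [_ Yn nmin]].
rewrite /visits big_ord_recr/= mem_set// big1// => i _.
apply/eqP; rewrite eqb0; apply/negP => /set_mem Yi.
by have := nmin i.+1 isT Yi; rewrite ltnS leqNgt ltn_ord.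
Qed.

(** Strong induction on [n], cutting the orbit at its first visit to [Y]: each step of the return
    map uses up exactly one visit. *)
Lemma iter_visits_firstret T Y n x : (0 < n)%N -> Y (iter n T x) ->
  iter (visits T Y n x) (firstret T Y) x = iter n T x.
Proof.
have [N] := ubnP n; elim: N n x => // N IH n x nN n0 Yn.
have hx : hits T Y x by exists n.
have [h0 Yh hmin] := hitnP hx; have hn := hmin _ n0 Yn.
rewrite -{1}(subnKC hn) visitsD visits_hitn// add1n iterSr -/(firstret T Y x).
have [e|ne] := eqVneq (n - hitn T Y x)%N 0%N.
  rewrite e /visits big_ord0/= /firstret; congr iter.
  by apply/eqP; rewrite eqn_leq hn -subn_eq0 e.
rewrite -[in RHS](subnK hn) iterD -/(firstret T Y x).
apply: IH; rewrite ?lt0n//.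
  by rewrite -ltnS (leq_trans _ nN)// ltnS ltn_subrL h0.
by rewrite /firstret -iterD subnK.
Qed.

(** Converse reading of the return map, used for minimality of the induced hitting time: every
    induced time [i] comes from a true time [n]. Since each return lasts at least one step,
    [i <= n], so [n] is positive when [i] is. *)
Lemma iter_firstret_visits T Y i x : recurrent T Y x ->
  exists n, [/\ iter i (firstret T Y) x = iter n T x, visits T Y n x = i & (i <= n)%N].
Proof.
move=> rx; elim: i => [|i [n [IH vn le_in]]].
  by exists 0%N; rewrite /visits big_ord0.
have hn := recurrent_hits (recurrent_iter n rx).
exists (n + hitn T Y (iter n T x))%N; split.
- by rewrite iterS IH addnC iterD.
- by rewrite visitsD vn visits_hitn// addn1.
- by have [h0 _ _] := hitnP hn; rewrite -addn1 leq_add.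
Qed.

Lemma recurrentS T A Y : A `<=` Y -> recurrent T A `<=` recurrent T Y.
Proof. by move=> AY x Ax N; have [n [Nn /AY]] := Ax N; exists n. Qed.

(** At the first hit of [A] the orbit is in [Y], so the return map gets there after as many steps as
    there were visits. An induced hit at step [i] happens at a true time no earlier than the first
    hit, and visit counts are monotone in time. *)
Lemma hitn_induced T A Y x : A `<=` Y -> recurrent T A x ->
  hits (firstret T Y) A x /\
  hitn (firstret T Y) A x = visits T Y (hitn T A x) x.
Proof.
move=> AY rx; have hx := recurrent_hits rx; have [h0 Ah hmin] := hitnP hx.
set h := hitn T A x in h0 Ah hmin *.
have itv := iter_visits_firstret h0 (AY _ Ah).
have v0 : (0 < visits T Y h x)%N.
  rewrite /visits; case: (h) h0 Ah => // n _ An.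
  by rewrite big_ord_recr/= mem_set ?addn1//; exact: AY.
split; first by exists (visits T Y h x); rewrite itv.
apply: hitn_unique => //; first by rewrite itv.
move=> i i0 Ai; have [n [ein vn le_in]] := iter_firstret_visits i (recurrentS AY rx).
rewrite -vn; apply: visits_leq; apply: hmin; first exact: leq_trans le_in.
by rewrite -ein.
Qed.

(** Visit counts add up along consecutive orbit segments, so the identity for one hitting time
    telescopes over successive returns. *)
Lemma sum_hitn_induced T A Y k x : A `<=` Y -> recurrent T A x ->
  (\sum_(j < k) hitn (firstret T Y) A (iter j (firstret T A) x))%N =
  visits T Y (hsum T A k x) x.
Proof.
move=> AY rx; elim: k => [|k IH]; first by rewrite /hsum !big_ord0 /visits big_ord0.
rewrite big_ord_recr/= IH /hsum big_ord_recr/= visitsD; congr addn.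
have [_ ->] := hitn_induced AY (recurrent_firstret k rx).
by rewrite iter_firstret.
Qed.

Lemma hitn_shift T A x : recurrent T A x -> ~ A (T x) ->
  hitn T A x = (hitn T A (T x)).+1.
Proof.
move=> rx nA; have rTx : recurrent T A (T x) by exact: (recurrent_iter 1 rx).
have [h0 Ah hmin] := hitnP (recurrent_hits rTx).
apply: hitn_unique => //; first by rewrite iterSr.
move=> [//|[|m]] _ Am; first by case: nA.
by rewrite ltnS; apply: hmin; rewrite -?iterSr.
Qed.

(** The first visit of [x] to [A] after time [0] is also that of [T x], only seen one step later;
    from this point on both orbits of returns coincide. *)
Lemma firstret_shift T A k x : recurrent T A x -> ~ A (T x) ->
  iter k.+1 (firstret T A) (T x) = iter k.+1 (firstret T A) x.
Proof.
by move=> rx nA; rewrite !iterSr /firstret (hitn_shift rx nA) iterSr.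
Qed.

End hitting.

(** * Compactness of the state space and uniform continuity of test functions *)

Section topology.
Context {R : realType}.

(** Transported from the segment [[-1, 1]]: a cluster point of the image filter under [contract] is
    pulled back by [expand]. *)
Lemma ereal_compact : compact [set: \bar R].
Proof.
move=> G PG _; pose H := (@contract R) @ G.
have PH : ProperFilter H by exact: fmap_proper_filter.
have Hc : H `[-1, 1]%classic.
  suff : G (@contract R @^-1` `[-1, 1]%classic) by [].
  by apply: filterE => y; rewrite /= in_itv/=; have := contract_le1 y; rewrite ler_norml.
have [r [rI clr]] := @segment_compact R (-1) 1 H PH Hc.
exists (expand r); split => // A B GA /nbhs_ballP[e /= e0 eB].
have HA : H (@contract R @` A).
  suff : G (@contract R @^-1` (@contract R @` A)) by [].
  by apply: filterS GA => y Ay; exists y.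
have [_ [[y Ay <-] ry]] := clr _ _ HA (nbhsx_ballx r e e0).
exists y; split=> //; apply: eB; rewrite /ball/= /ereal_ball expandK//.
by move: rI; rewrite inE /= in_itv/= ler_norml.
Qed.

Lemma cvg_ptws (J : Type) (G : set_system J) {FG : Filter G}
    (S : topologicalType) (a : J -> {ptws nat -> S}) (a0 : {ptws nat -> S}) :
  (forall k, (fun j => a j k) @ G --> a0 k) -> a @ G --> a0.
Proof.
move=> ca; apply/cvg_sup => k U [V] [[W] oW <-] Wa WU.
apply: (filterS WU); apply: (ca k); exact: open_nbhs_nbhs.
Qed.

Lemma cvg_Espace (F : topologicalType) (J : Type) (G : set_system J)
    {FG : Filter G} (z : J -> Espace R F) (z0 : Espace R F) :
  (forall k, (fun j => (z j).1 k) @ G --> z0.1 k) ->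
  (forall k, (fun j => (z j).2 k) @ G --> z0.2 k) -> z @ G --> z0.
Proof.
move=> c1 c2.
have h1 : (fun j => (z j).1) @ G --> z0.1 by exact: cvg_ptws c1.
have h2 : (fun j => (z j).2) @ G --> z0.2 by exact: cvg_ptws c2.
have -> : z = (fun j => ((z j).1, (z j).2)).
  by apply/funext => j; exact: surjective_pairing.
rewrite [z0]surjective_pairing.
exact: (@cvg_pair _ _ _ _ _ _ _ (nbhs_filter _) (nbhs_filter _) _ _ h1 h2).
Qed.

Lemma Espace_compact (F : topologicalType) :
  compact [set: F] -> compact [set: Espace R F].
Proof.
move=> cF; rewrite -setXTT; apply: compact_setX.
  have := @tychonoff nat (fun=> \bar R) (fun=> setT) (fun=> ereal_compact).
  by congr compact; apply/seteqP; split.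
have := @tychonoff nat (fun=> F) (fun=> setT) (fun=> cF).
by congr compact; apply/seteqP; split.
Qed.

(** Uniform continuity from compactness, restricted to the case needed: only the return times are
    perturbed, and only finitely many of them have to be close. *)
Lemma continuous_Espace_uniform (F : topologicalType) (f : Espace R F -> R)
    (e : R) : compact [set: F] -> continuous f -> 0 < e ->
  exists n : nat, forall (z : Espace R F) (a : {ptws nat -> \bar R}),
    (forall k, (k < n)%N -> ball (z.1 k) n.+1%:R^-1 (a k)) ->
    `|f z - f (a, z.2)| <= e.
Proof.
move=> cF cf e0.
pose close (n : nat) (z : Espace R F) (a : {ptws nat -> \bar R}) :=
  forall k, (k < n)%N -> ball (z.1 k) n.+1%:R^-1 (a k).
have closeS n m z a : (n <= m)%N -> close m z a -> close n z a.
  move=> nm zma k kn; apply: le_ball (zma k (leq_trans kn nm)).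
  by rewrite lef_pV2 ?posrE// ler_nat.
have /compact_near_coveringP ncov := Espace_compact cF.
pose P n (z : Espace R F) := forall a, close n z a -> `|f z - f (a, z.2)| <= e.
suff: \forall n \near \oo, [set: Espace R F] `<=` P n.
  by move=> [n _ /(_ n (leqnn n)) nP]; exists n => z a; exact: nP.
apply: (ncov nat \oo P) => z0 _.
(* Along [G] the point [z] tends to [z0] while [a] gets close to the times of [z]; hence [z] and
   [(a, z.2)] both converge to [z0], and continuity at [z0] compares their values. *)
pose G : set_system (Espace R F * {ptws nat -> \bar R}) :=
  filter_from [set VN : set (Espace R F) * nat | nbhs z0 VN.1]
    (fun VN => [set p | VN.1 p.1 /\ close VN.2 p.1 p.2]).
have FG : Filter G.
  apply: filter_from_filter; first by exists (setT, 0%N) => /=; exact: filterT.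
  move=> [V N] [V' N'] /= zV zV'; exists (V `&` V', maxn N N') => /=.
    exact: filterI.
  by move=> [z a] /= [[Vz V'z] cl]; split; split=> //; apply: closeS cl;
    rewrite ?leq_maxl ?leq_maxr.
have c1 : fst @ G --> z0.
  by move=> V zV; exists (V, 0%N) => // -[z a] [].
have c12 : (fun p => p.1.2) @ G --> z0.2.
  by apply: cvg_comp c1 _; exact: cvg_snd.
have c2 : (fun p => p.2) @ G --> z0.1.
  apply: cvg_ptws => k U /nbhs_ballP[r /= r0 rU].
  have r20 : 0 < r / 2 by rewrite divr_gt0.
  have [N Nr] : exists N : nat, N.+1%:R^-1 < r / 2.
    have [N] := ltr_add_invr r20; rewrite add0r => h; exists N; exact: h.
  have V1 : nbhs z0 [set z : Espace R F | ball (z0.1 k) (r / 2) (z.1 k)].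
    have cz : (fun z : Espace R F => z.1 k) @ z0 --> z0.1 k.
      have := @proj_continuous nat (fun=> \bar R) k z0.1.
      by apply: cvg_comp; exact: cvg_fst.
    by apply: cz; exact: nbhsx_ballx.
  (* The index has to exceed [k] for coordinate [k] to be constrained, and [N] to make the radius
     smaller than [r / 2]. *)
  exists ([set z : Espace R F | ball (z0.1 k) (r / 2) (z.1 k)], maxn N k.+1) => //=.
  move=> [z a] [/= zk cl]; apply: rU; rewrite [r]splitr; apply: ball_triangle zk _.
  apply: le_ball (cl k _); last by rewrite leq_max ltnSn orbT.
  by rewrite (le_trans _ (ltW Nr))// lef_pV2 ?posrE// ler_nat ltnS leq_maxl.
have c22 : (fun p => (p.2, p.1.2) : Espace R F) @ G --> z0.
  rewrite [z0]surjective_pairing.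
  exact: (@cvg_pair _ _ _ _ _ _ _ (nbhs_filter _) (nbhs_filter _) _ _ c2 c12).
have e20 : 0 < e / 2 by rewrite divr_gt0.
have /cvgrPdist_lt/(_ _ e20) h1 := cvg_comp _ _ c1 (cf z0).
have /cvgrPdist_lt/(_ _ e20) h2 := cvg_comp _ _ c22 (cf z0).
have [[V N] /= zV VN] : G [set p | `|f z0 - f p.1| < e / 2 /\
    `|f z0 - f (p.2, p.1.2)| < e / 2] by exact: filterI.
exists (V, [set n | (N <= n)%N]) => /=; first by split=> //; exists N.
move=> [z n] [/= Vz Nn] a cl.
have [/= h3 h4] := VN (z, a) (conj Vz (closeS _ _ _ _ Nn cl)).
rewrite (_ : f z - f _ = (f z0 - f (a, z.2)) - (f z0 - f z)); last by ring.
by rewrite (le_trans (ler_normB _ _))// [e]splitr lerD// ltW.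
Qed.

(** Balls of the extended reals are measured through [contract], which on nonnegative reals is
    [x / (1 + x)] and is 1-Lipschitz there. *)
Lemma ball_EFin_ge0 (x y e : R) : 0 <= x -> 0 <= y -> `|x - y| < e ->
  ball x%:E e y%:E.
Proof.
move=> x0 y0; rewrite /ball/= /ereal_ball/= (ger0_norm x0) (ger0_norm y0).
apply: le_lt_trans.
have p1 : 0 < 1 + x by rewrite ltr_wpDr.
have p2 : 0 < 1 + y by rewrite ltr_wpDr.
have -> : x / (1 + x) - y / (1 + y) = (x - y) / ((1 + x) * (1 + y)).
  by field; rewrite !gt_eqF.
rewrite normrM ler_piMr// normfV invf_le1 ?normr_gt0 ?gt_eqF ?mulr_gt0//.
rewrite ger0_norm ?mulr_ge0 ?(ltW p1) ?(ltW p2)//; nra.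
Qed.

(** States with finite return times; at recurrent points both processes take this form, and so does
    the limit. *)
Definition realpt {F : topologicalType} (a : nat -> R) (b : nat -> F) : Espace R F :=
  ((fun k => (a k)%:E) : {ptws nat -> \bar R}, b : {ptws nat -> F}).

Lemma continuous_realpt_uniform (F : topologicalType) (f : Espace R F -> R)
    (e : R) : compact [set: F] -> continuous f -> 0 < e ->
  exists (n : nat) (r : R), 0 < r /\ forall (a a' : nat -> R) (b : nat -> F),
    (forall k, 0 <= a k) -> (forall k, 0 <= a' k) ->
    (forall k, (k < n)%N -> `|a k - a' k| <= r) ->
    `|f (realpt a b) - f (realpt a' b)| <= e.
Proof.
move=> cF cf e0; have [n fn] := continuous_Espace_uniform cF cf e0.
exists n, (n.+1%:R^-1 / 2); split; first by rewrite divr_gt0.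
move=> a a' b a0 a'0 aa'; apply: (fn (realpt a b)) => k kn.
apply: ball_EFin_ge0 => //; rewrite (le_lt_trans (aa' k kn))//.
by rewrite ltr_pdivrMr// ltr_pMr// ltr1n.
Qed.

End topology.

(** * Measurability of continuous functions of countably coded sequences *)

Section measurability.
Context {R : realType} {d : measure_display} {X : measurableType d}.

(** The centres are enumerated so that a point can be sent to its first suitable index. Interiors
    are used because only preimages of open sets are known to be measurable. *)
Lemma compact_net (F : pseudoMetricType R) (z0 : F) (e : R) :
  compact [set: F] -> 0 < e ->
  exists p : nat -> F, forall z, exists i, (ball (p i) e)° z.
Proof.
move=> /compact_near_coveringP cF e0.
(* Finite lists directed by inclusion: being covered by a list is a near-covering property for this
   filter, so compactness yields a single list. *)
pose G := filter_from [set: seq F] (fun s => [set t : seq F | {subset s <= t}]).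
have FG : Filter G.
  apply: filter_from_filter; first by exists [::].
  move=> s t _ _; exists (s ++ t) => // u /= stu.
  by split=> w ws; apply: stu; rewrite mem_cat ws ?orbT.
pose P (s : seq F) z := exists2 w, w \in s & (ball w e)° z.
have : \forall s \near G, [set: F] `<=` P s.
  apply: (cF _ G P) => z _.
  exists ((ball z e)°, [set t : seq F | z \in t]) => /=.
    split; last by exists [:: z] => // t; apply; rewrite mem_head.
    by apply: open_nbhs_nbhs; split; [exact: open_interior|exact: nbhsx_ballx].
  by move=> [z' s] /= [zz' zs]; exists z.
move=> [s _ /(_ s (fun _ => id)) cov]; exists (nth z0 s) => z.
have [w wD wz] := cov z I; exists (index w s).
by rewrite nth_index.
Qed.

Lemma measurable_mkseq_fiber (D : set X) (h : nat -> X -> nat) m (s : seq nat) :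
  measurable D -> (forall k v, measurable (D `&` [set x | h k x = v])) ->
  measurable (D `&` [set x | mkseq (h^~ x) m = s]).
Proof.
move=> mD mh; elim: m s => [|m IH] s.
  have [->|ns] := eqVneq s [::].
    by rewrite (_ : mkset _ = setT) ?setIT//; apply/seteqP; split.
  rewrite (_ : mkset _ = set0) ?setI0//; apply/seteqP; split => // x /= e.
  by rewrite -e in ns.
case/lastP: s => [|s v].
  rewrite (_ : mkset _ = set0) ?setI0//; apply/seteqP; split => // x /=.
rewrite (_ : _ `&` _ = (D `&` [set x | mkseq (h^~ x) m = s]) `&`
                       (D `&` [set x | h m x = v])); last first.
  apply/seteqP; split => x /=.
    by move=> [Dx]; rewrite mkseqS => /rcons_inj[-> ->].
  by move=> [[Dx <-] [_ <-]]; rewrite mkseqS.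
exact: measurableI.
Qed.

(* [f] is the pointwise limit of its values at countably valued
   approximations of the point. *)
Lemma measurable_continuous_Espace (F : pseudoMetricType R)
    (f : Espace R F -> R) (D : set X) (g : nat -> \bar R)
    (h : nat -> X -> nat) (b : nat -> X -> F) :
  compact [set: F] -> continuous f -> measurable D ->
  (forall k v, measurable (D `&` [set x | h k x = v])) ->
  (forall k (U : set F), open U -> measurable (D `&` b k @^-1` U)) ->
  measurable_fun D (fun x => f ((fun k => g (h k x)) : {ptws nat -> \bar R},
                              (fun k => b k x) : {ptws nat -> F})).
Proof.
move=> cF cf mD mh mb.
(* A point of [D] provides a point of [F], the default centre required by [compact_net]. *)
have [->|/set0P[x0 Dx0]] := eqVneq D set0.
  by move=> _ B _; rewrite set0I.
pose z0 := b 0%N x0.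
have /choice[p pP] : forall m : nat, exists p : nat -> F,
    forall z, exists i, (ball (p i) m.+1%:R^-1)° z.
  by move=> m; apply: compact_net.
have pP' m z : exists i, z \in ((ball (p m i) m.+1%:R^-1)° : set F).
  by have [i zi] := pP m z; exists i; rewrite mem_set.
pose idx m z := ex_minn (pP' m z).
have idxP m z : ball (p m (idx m z)) m.+1%:R^-1 z.
  by rewrite /idx; case: ex_minnP => i /set_mem/interior_subset.
have midx m k v : measurable (D `&` [set x | idx m (b k x) = v]).
  pose U i : set F := (ball (p m i) m.+1%:R^-1)°.
  have mU i : measurable (D `&` b k @^-1` U i) by apply: mb; exact: open_interior.
  rewrite (_ : _ `&` _ = (D `&` b k @^-1` U v) `\`
      \bigcup_(i in `I_v) (D `&` b k @^-1` U i)); last first.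
    apply/seteqP; split => x /=.
      move=> [Dx]; rewrite /idx; case: ex_minnP => i /set_mem Ui imin <-.
      split=> // -[j /= ji [_ Uj]].
      by have := imin j; rewrite mem_set// => /(_ isT); rewrite leqNgt ji.
    move=> [[Dx Uv] nU]; split=> //; rewrite /idx; case: ex_minnP => i /set_mem Ui imin.
    apply/eqP; rewrite eqn_leq imin ?mem_set//= leqNgt; apply/negP => iv.
    by apply: nU; exists i.
  by apply: measurableD => //; apply: bigcup_measurable => i _; exact: mU.
(* The first [m] coordinates of both components, the second rounded to the net of radius
   [1 / (m + 1)]. The code lies in a countable type, and its decoding by [q] converges to the true
   point. *)
pose code m x := (mkseq (h^~ x) m, mkseq (fun k => idx m (b k x)) m).
pose q m (st : seq nat * seq nat) : Espace R F :=
  ((fun k => g (nth 0%N st.1 k)) : {ptws nat -> \bar R},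
   (fun k => p m (nth 0%N st.2 k)) : {ptws nat -> F}).
apply: (@measurable_fun_cvg _ _ _ D (fun m x => f (q m (code m x)))).
  move=> m _ B mB.
  apply: (measurable_countable_fibers (c := code m) ((f \o q m) @^-1` B)).
  move=> [s t].
  rewrite (_ : _ `&` _ = (D `&` [set x | mkseq (h^~ x) m = s]) `&`
     (D `&` [set x | mkseq (fun k => idx m (b k x)) m = t])); last first.
    apply/seteqP; split => x /=; first by move=> [Dx [<- <-]].
    by move=> [[Dx <-] [_ <-]].
  apply: measurableI; first exact: measurable_mkseq_fiber.
  exact: (measurable_mkseq_fiber (h := fun k x => idx m (b k x))).
move=> x Dx.
apply: (cvg_comp (fun m => q m (code m x)) f); last exact: cf.
apply: cvg_Espace => k /=.
  apply: cvg_near_cst; exists k.+1 => // m /= km.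
  by rewrite nth_mkseq.
apply/cvg_ballP => e e0; have [N] := ltr_add_invr e0; rewrite add0r => Ne.
exists (maxn N k.+1) => // m /=; rewrite geq_max => /andP[Nm km].
rewrite nth_mkseq//; apply: ball_sym; apply: le_ball (idxP m (b k x)).
by rewrite (le_trans _ (ltW Ne))// lef_pV2 ?posrE// ler_nat.
Qed.

End measurability.

(** * Almost invariant functions are asymptotically uncorrelated with [Y] *)

Section asymptotic_invariance.
Context {R : realType} {d : measure_display} {X : measurableType d}.
Variables (mu : probability X R) (T : X -> X).
Hypotheses (muT : measure_preserving mu T) (ergT : ergodic mu T).
Let mT : measurable_fun setT T := muT.1.
Local Notation E := (Rintegral mu setT).

(** Triangle inequality along the orbit; by invariance of [mu] each of the [j] increments has the
    same mean absolute value. *)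
Lemma exp_iter_shift (g : X -> R) j : bmf g ->
  E (fun x => `|g (iter j T x) - g x|) <=
  j%:R * E (fun x => `|g (T x) - g x|).
Proof.
move=> bg; have bgi i : bmf (g \o iter i T).
  by apply: bmf_comp => //; exact: measurable_iter.
have bd h : bmf h -> bmf (fun x => `|h x - g x|).
  by move=> bh; apply: bmf_norm; exact: bmfB.
have bgT : bmf (fun x => `|(g \o T) x - g x|) by exact/bd/(bgi 1%N).
elim: j => [|j IH].
  rewrite mul0r (_ : (fun x => _) = fun=> 0) ?exp_cst//.
  by apply/funext => x; rewrite /= subrr normr0.
rewrite -natr1 mulrDl mul1r; apply: le_trans (lerD IH (lexx _)).
have bgTj : bmf ((fun x => `|(g \o T) x - g x|) \o iter j T).
  by apply: bmf_comp => //; exact: measurable_iter.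
have <- : E ((fun x => `|(g \o T) x - g x|) \o iter j T) = E (fun x => `|g (T x) - g x|).
  elim: j {IH bgTj} => // j IH; rewrite -IH.
  rewrite -[RHS](exp_preserving muT); last first.
    by apply: bmf_comp => //; exact: measurable_iter.
  by congr Rintegral; apply/funext => x /=; rewrite -iterS !iterSr.
rewrite -expD; [|exact: (bd _ (bgi j))|exact: bgTj].
apply: exp_le; [exact: (bd _ (bgi j.+1)) | by apply: bmfD bgTj; exact: (bd _ (bgi j))|].
move=> x /=; rewrite [leRHS]addrC (le_trans _ (ler_normD _ _))//.
by rewrite addrA subrK.
Qed.

Lemma visits_leq_time (Y : set X) n x : (visits T Y n x <= n)%N.
Proof.
rewrite -[leqRHS]card_ord -sum1_card; apply: leq_sum => i _.
exact: leq_b1.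
Qed.

(** By invariance and almost invariance of [g l], the indicator of [Y] may be replaced by its
    translate under [T^i]. Averaging over [i = 1, ..., n] turns it into [visits T Y n x / n], which
    is close to [m] off a small set. *)
Lemma asymptotic_mean (Y : set X) (g : nat -> X -> R) (M' : R) : measurable Y ->
  (forall l, bmf (g l)) -> (forall l x, `|g l x| <= M') ->
  (forall e, 0 < e -> \forall l \near \oo, E (fun x => `|g l (T x) - g l x|) <= e) ->
  forall e, 0 < e -> \forall l \near \oo,
    `|E (fun x => g l x * \1_Y x) - Pr mu Y * E (g l)| <= e.
Proof.
move=> mY bg gM0 shift e e0; set m := Pr mu Y.
have [M M0 gM] : exists2 N, 0 <= N & forall l x, `|g l x| <= N.
  by exists `|M'| => // l x; rewrite (le_trans (gM0 l x))// ler_norm.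
have M10 : 0 < M + 1 by rewrite ltr_wpDl.
(* The ergodic error consists of three terms of size at most [e1 * n], contributing [3 / 4 * e]
   after division by [n]; almost invariance contributes the remaining [e / 4]. *)
pose e1 := e / (4 * (M + 1)).
have e10 : 0 < e1 by rewrite divr_gt0// mulr_gt0.
have [C [B [mB PB visB]]] := visits_ergodic muT ergT mY e10 e10.
(* The block length absorbs the constant [C] and is fixed before [l], so the shift error may then be
   required to be below [e / (4 * n)]. *)
have [n n0 nC] : exists2 n : nat, (0 < n)%N & C%:R <= e1 * n%:R.
  exists (Num.bound (C%:R / e1)).+1 => //.
  rewrite mulrC -ler_pdivrMr// (le_trans (ltW (archi_boundP _)))//.
    by rewrite divr_ge0// ltW.
  by rewrite ler_nat.
have n0R : 0 < n%:R :> R by rewrite ltr0n.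
have e20 : 0 < e / (4 * n%:R) by rewrite divr_gt0// mulr_gt0.
apply: filterS (shift _ e20) => l Dl.
set D := E (fun x => `|g l (T x) - g l x|) in Dl.
have b1Y : bmf (\1_Y : X -> R) by exact: bmf_indic.
have b1Yi i : bmf (fun x => \1_Y (iter i T x) : R).
  by apply: (bmf_comp (T := iter i T)) => //; exact: measurable_iter.
have bgi i : bmf (fun x => g l (iter i T x)).
  by apply: (bmf_comp (T := iter i T)) => //; exact: measurable_iter.
have step i : (i <= n)%N ->
    `|E (fun x => g l x * \1_Y x) - E (fun x => g l x * \1_Y (iter i T x))| <= n%:R * D.
  move=> i_n.
  have -> : E (fun x => g l x * \1_Y x) =
            E (fun x => g l (iter i T x) * \1_Y (iter i T x)).
    elim: i {i_n} => // i ->.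
    rewrite -[LHS](exp_preserving muT); last exact: bmfM.
    by congr Rintegral; apply/funext => x /=; rewrite -iterS !iterSr.
  rewrite -expB; [|exact: bmfM|exact: bmfM].
  apply: le_trans (exp_norm _ _) _; first by apply: bmfB; exact: bmfM.
  apply: le_trans (_ : E (fun x => `|g l (iter i T x) - g l x|) <= _).
    apply: exp_le; [by apply/bmf_norm/bmfB; exact: bmfM|by apply/bmf_norm/bmfB|].
    move=> x; rewrite -mulrBl normrM ler_piMr// indicE.
    by case: (_ \in _); rewrite ?normr1 ?normr0.
  apply: le_trans (exp_iter_shift _ _) _ => //.
  rewrite ler_wpM2r ?ler_nat//; apply: Rintegral_ge0 => x _; exact: normr_ge0.
have bvis : bmf (fun x => (visits T Y n x)%:R : R).
  rewrite (_ : (fun x => _) = (fun x => \sum_(i < n) \1_Y (iter i.+1 T x))).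
    by apply: (bmf_sum n (g := fun i x => \1_Y (iter i.+1 T x) : R)) => i.
  by apply/funext => x; rewrite /visits natr_sum; apply: eq_bigr => i _; rewrite indicE.
have Evis : `|n%:R * E (fun x => g l x * \1_Y x) -
    E (fun x => g l x * (visits T Y n x)%:R)| <= n%:R * (n%:R * D).
  have -> : E (fun x => g l x * (visits T Y n x)%:R) =
      \sum_(i < n) E (fun x => g l x * \1_Y (iter i.+1 T x)).
    rewrite -(exp_sum mu n (g := fun i x => g l x * \1_Y (iter i.+1 T x))); last first.
      by move=> i; exact: bmfM.
    congr Rintegral; apply/funext => x; rewrite /visits natr_sum mulr_sumr.
    by apply: eq_bigr => i _; rewrite indicE.
  have sumcst (r : R) : n%:R * r = \sum_(i < n) r.
    by rewrite sumr_const card_ord mulr_natl.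
  rewrite 2!sumcst -sumrB.
  apply: le_trans (ler_norm_sum _ _ _) _; apply: ler_sum => i _; exact: step.
have m01 : 0 <= m <= 1.
  rewrite Pr_ge0 /m Pr_exp// -[leRHS](exp_cst mu).
  by apply: exp_le => //; exact: bmf_cst.
have Emean : `|E (fun x => g l x * (visits T Y n x)%:R) - n%:R * (m * E (g l))| <=
    M * (e1 * n%:R + C%:R + n%:R * e1).
  rewrite mulrA -expZ// -expB; [|exact: bmfM|exact: bmfM (bmf_cst _) _].
  apply: le_trans (exp_norm _ _) _.
    by apply: bmfB; [exact: bmfM|exact: bmfM (bmf_cst _) _].
  have b1B := bmf_indic (R := R) mB.
  apply: le_trans (_ : E (fun x => M * (e1 * n%:R + C%:R + n%:R * \1_B x)) <= _).
    apply: exp_le.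
    - apply: bmf_norm; apply: bmfB; [exact: bmfM|exact: bmfM (bmf_cst _) _].
    - by apply: bmfM (bmf_cst _) _; apply: bmfD (bmf_cst _) _; exact: bmfM (bmf_cst _) _.
    move=> x; rewrite [n%:R * m * _]mulrC -mulrBr normrM ler_pM//.
    rewrite [n%:R * m]mulrC indicE; have [xB|/negP xB] := boolP (x \in B); last first.
      rewrite mulr0 addr0; apply: visB => Bx; apply: xB; exact: mem_set.
    (* On the exceptional set the visit count and [m * n] both lie between [0] and [n]. *)
    rewrite mulr1; apply: le_trans (_ : n%:R <= _); last first.
      by rewrite lerDr addr_ge0// mulr_ge0// ltW.
    have vn : (visits T Y n x)%:R <= n%:R :> R by rewrite ler_nat visits_leq_time.
    have v0 := ler0n R (visits T Y n x).
    case/andP: m01 => m0 m1.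
    have mn0 : 0 <= m * n%:R by rewrite mulr_ge0.
    have mn1 : m * n%:R <= n%:R by rewrite ler_piMl.
    rewrite ler_norml; apply/andP; split; lra.
  rewrite expZ; last by apply: bmfD (bmf_cst _) _; exact: bmfM (bmf_cst _) _.
  rewrite expD; [|exact: bmf_cst|exact: bmfM (bmf_cst _) _].
  rewrite exp_cst expZ// exp_indic//; apply: ler_wpM2l => //.
  by rewrite lerD2l ler_wpM2l.
have e1M : M * (e1 * n%:R + C%:R + n%:R * e1) <= n%:R * (3 / 4 * e).
  apply: le_trans (_ : (M + 1) * (3 * (e1 * n%:R)) <= _).
    apply: ler_pM => //; rewrite ?lerDl//.
      by rewrite !addr_ge0// mulr_ge0// ltW.
    move: nC; rewrite [n%:R * e1]mulrC; lra.
  rewrite le_eqVlt; apply/orP; left; apply/eqP; rewrite /e1; field.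
  by rewrite gt_eqF.
have nD : n%:R * (n%:R * D) <= n%:R * (e / 4).
  rewrite ler_pM2l// mulrC -ler_pdivlMr// (le_trans Dl)//.
  by rewrite invfM mulrA.
rewrite -(ler_pM2l n0R) -{1}(ger0_norm (ltW n0R)) -normrM mulrBr.
rewrite (_ : _ - _ = (n%:R * E (fun x => g l x * \1_Y x) -
    E (fun x => g l x * (visits T Y n x)%:R)) +
   (E (fun x => g l x * (visits T Y n x)%:R) - n%:R * (m * E (g l)))); last first.
  by rewrite addrA subrK.
apply: le_trans (ler_normD _ _) _; apply: le_trans (lerD Evis Emean) _.
apply: le_trans (lerD nD e1M) _; rewrite -mulrDr ler_pM2l//; lra.
Qed.

End asymptotic_invariance.

(** * Continuous test functions that detect large return times *)

Section escape_test.
Context {R : realType} {F : topologicalType}.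

Lemma contract_continuous : continuous (@contract R).
Proof.
move=> x; apply/cvgrPdist_lt => e e0.
by have := nbhsx_ballx (x : \bar R) e e0; apply: filterS.
Qed.

(* Vanishes where the [k]-th return time is at most [j - 1] and is at least [1]
   where it exceeds [2 j]. *)
Definition escape_test k (j : nat) (z : Espace R F) : R :=
  let s := 1 - j%:R * (1 - contract (z.1 k)) in `|s| + s.

Lemma escape_test_continuous k j : continuous (escape_test k j).
Proof.
move=> z; have cz : (fun z : Espace R F => contract (z.1 k)) @ z --> contract (z.1 k).
  have cz1 : (fun z : Espace R F => z.1 k) @ z --> z.1 k.
    have := @proj_continuous nat (fun=> \bar R) k z.1.
    by apply: cvg_comp; exact: cvg_fst.
  by apply: cvg_comp cz1 _; exact: contract_continuous.
pose p (y : R) := 1 - j%:R * (1 - y).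
have cp : continuous p.
  move=> y; apply: cvgB; first exact: cvg_cst.
  apply: cvgM; first exact: cvg_cst.
  by apply: cvgB; [exact: cvg_cst|exact: cvg_id].
have cq : continuous (fun y => `|p y| + p y).
  by move=> y; apply: cvgD; [apply: cvg_norm; exact: cp|exact: cp].
exact: cvg_comp cz (cq _).
Qed.

Lemma escape_test_ge0 k j z : 0 <= escape_test k j z.
Proof. by rewrite /escape_test -lerBlDr sub0r -normrN ler_norm. Qed.

Lemma escape_test_le2 k j z : escape_test k j z <= 2.
Proof.
rewrite /escape_test; have := contract_le1 (z.1 k).
rewrite ler_norml => /andP[_ c1].
have : 0 <= j%:R * (1 - contract (z.1 k)) by rewrite mulr_ge0// subr_ge0.
set s := j%:R * _ => s0.
by case: (ger0P (1 - s)) => _; lra.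
Qed.

Lemma escape_test_bounded k j : exists M : R, forall z, `|escape_test k j z| <= M.
Proof.
by exists 2 => z; rewrite ger0_norm ?escape_test_ge0// escape_test_le2.
Qed.

Lemma escape_test_realpt k j (a : nat -> R) b : 0 <= a k ->
  escape_test k j (realpt a b) = `|1 - j%:R / (1 + a k)| + (1 - j%:R / (1 + a k)).
Proof.
move=> ak0; rewrite /escape_test /=.
have -> // : 1 - a k / (1 + `|a k|) = (1 + a k)^-1.
by rewrite ger0_norm//; field; rewrite gt_eqF// ltr_wpDr.
Qed.

Lemma escape_test_small k (j : nat) (a : nat -> R) b : 0 <= a k -> a k <= j%:R ->
  escape_test k j.+1 (realpt a b) <= 0.
Proof.
move=> ak0 akj; rewrite escape_test_realpt//.
have : 1 - j.+1%:R / (1 + a k) <= 0.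
  by rewrite subr_le0 ler_pdivlMr ?ltr_wpDr// mul1r -natr1 addrC lerD2r.
by move=> s0; rewrite ler0_norm// addNr.
Qed.

Lemma escape_test_large k (j : nat) (a : nat -> R) b : 0 <= a k ->
  2 * j%:R < a k -> 1 <= escape_test k j (realpt a b).
Proof.
move=> ak0 akj; rewrite escape_test_realpt//.
have : j%:R / (1 + a k) <= 1 / 2.
  by rewrite ler_pdivrMr ?ltr_wpDr//; lra.
set s := _ / _ => s2.
by rewrite ger0_norm; lra.
Qed.

Lemma measurable_escape_test {d : measure_display} {X : measurableType d} k j
    (a : X -> nat -> R) (b : X -> nat -> F) :
  measurable_fun setT (a ^~ k) ->
  measurable_fun setT (fun x => escape_test k j (realpt (a x) (b x))).
Proof.
move=> ma; rewrite /escape_test/=.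
have mc : measurable_fun setT (fun r : R => contract r%:E).
  by apply: nondecreasing_measurable => // r r' rr'; rewrite le_contract.
have ms : measurable_fun setT (fun x => 1 - j%:R * (1 - contract (a x k)%:E)).
  apply: measurable_funB; first exact: measurable_cst.
  apply: measurable_funM; first exact: measurable_cst.
  apply: measurable_funB; first exact: measurable_cst.
  exact: (measurableT_comp mc ma).
by apply: measurable_funD => //; exact: measurableT_comp.
Qed.

End escape_test.

Lemma cvg_close_iff {R : realType} (u v : nat -> R) (r : R) :
  (forall e, 0 < e -> \forall l \near \oo, `|u l - v l| <= e) ->
  u @ \oo --> r <-> v @ \oo --> r.
Proof.
move=> uv; have uv0 : (fun l => u l - v l) @ \oo --> 0.
  apply/cvgrPdist_le => e e0; apply: filterS (uv e e0) => l.
  by rewrite sub0r normrN.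
split=> h.
  have -> : v = (fun l => u l - (u l - v l)) by apply/funext => l; ring.
  by rewrite -[r]subr0; exact: cvgB.
have -> : u = (fun l => v l + (u l - v l)) by apply/funext => l; ring.
by rewrite -[r]addr0; exact: cvgD.
Qed.

(** * The scaled return processes: almost invariance, tightness and comparison *)

Section return_processes.
Context {R : realType} {d : measure_display} {X : measurableType d}.
Variables (mu : probability X R) (T : X -> X) (F : metricType R).
Variables (Y : set X) (A : nat -> set X) (psi : nat -> X -> F).
Hypotheses (cF : compact [set: F]) (muT : measure_preserving mu T)
  (ergT : ergodic mu T) (mY : measurable Y) (muY : (0 < mu Y)%E)
  (mA : forall l, measurable (A l)) (AY : forall l, A l `<=` Y)
  (muA : forall l, (0 < mu (A l))%E) (rareA : (mu \o A) @ \oo --> 0%E)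
  (mpsi : forall l, borel_measurable_on (A l) (psi l)).
Let mT : measurable_fun setT T := muT.1.
Local Notation E := (Rintegral mu setT).
Local Notation m := (Pr mu Y).
Local Notation c l := (Pr mu (A l)).
Local Notation H l := (recurrent T (A l)).

Let m0 : 0 < m. Proof. by rewrite -lte_fin -PrE. Qed.

Let c0 l : 0 < c l. Proof. by rewrite -lte_fin -PrE. Qed.

Let c_small (e : R) : 0 < e -> \forall l \near \oo, c l <= e.
Proof.
move=> e0; have /fine_cvgP[_ /cvgrPdist_le/(_ e e0)] := rareA.
by apply: filterS => l; rewrite sub0r normrN ger0_norm// Pr_ge0.
Qed.

Let mH l : measurable (H l). Proof. exact: (measurable_recurrent muT). Qed.

Let muH l : mu (H l) = 1%E. Proof. exact: (recurrent_full muT ergT). Qed.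

Let mfirst l k : measurable_fun setT (iter k (firstret T (A l))).
Proof. by apply: measurable_iter; exact: measurable_firstret. Qed.

(* The scaled return times [mu(A_l) Phi_{A_l}] and [mu_Y(A_l) Phi^Y_{A_l}],
   with the junk value [0] of [hitn] outside [H l]. *)
Definition wret l k x : R := c l * (hitn T (A l) (iter k (firstret T (A l)) x))%:R.

Definition vret l k x : R :=
  c l / m * (hitn (firstret T Y) (A l) (iter k (firstret T (A l)) x))%:R.

Definition bpos l k x : F := psi l (iter k.+1 (firstret T (A l)) x).

(** The test function evaluated on the process, set to [0] off the recurrent set [H l]. As [H l] is
    [T]-invariant of full measure, the cut changes no integral, respects the shift, and removes the
    points where hitting times are junk. *)
Definition local_obs (a : nat -> nat -> X -> R) (f : Espace R F -> R) l : X -> R :=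
  (fun x => f (realpt (a l ^~ x) (bpos l ^~ x))) \_ (H l).

Lemma wret_ge0 l k x : 0 <= wret l k x.
Proof. by rewrite mulr_ge0 ?Pr_ge0. Qed.

Lemma vret_ge0 l k x : 0 <= vret l k x.
Proof. by rewrite mulr_ge0 ?divr_ge0 ?Pr_ge0. Qed.

(** [psi l] is measurable only on [A l], but at recurrent points it is evaluated at returns, which
    lie in [A l]. *)
Let mbpos l k (U : set F) : open U -> measurable (H l `&` bpos l k @^-1` U).
Proof.
move=> oU; have [_ mU] := mpsi l.
rewrite (_ : _ `&` _ =
    H l `&` (iter k.+1 (firstret T (A l)) @^-1` (A l `&` psi l @^-1` U))); last first.
  apply/seteqP; split => x [Hx] /=; last by move=> [_ Ux].
  by move=> Ux; split=> //; split=> //; exact: mem_firstret.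
apply: measurableI => //; rewrite -[X in measurable X]setTI.
by apply: mfirst => //; exact: mU.
Qed.

(** Covers both processes, with [T'] the map [T] or its return map to [Y]. The times are functions
    of natural numbers, the countable data that [measurable_continuous_Espace] asks for. *)
Let bmf_local (a : nat -> nat -> X -> R) (T' : X -> X) (r : nat -> R) f l :
  measurable_fun setT T' ->
  (forall k x, a l k x = r l * (hitn T' (A l) (iter k (firstret T (A l)) x))%:R) ->
  continuous f -> (exists M : R, forall e, `|f e| <= M) -> bmf (local_obs a f l).
Proof.
move=> mT' aE cf [M fM]; split; last first.
  exists `|M| => x; rewrite /local_obs patchE; case: ifP; rewrite ?normr0// => _.
  by rewrite (le_trans (fM _))// ler_norm.
apply/measurable_restrict => //; rewrite setTI.
have mfun := @measurable_continuous_Espace R d X F f (H l) (fun n => (r l * n%:R)%:E)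
  (fun k x => hitn T' (A l) (iter k (firstret T (A l)) x)) (bpos l) cF cf (mH l).
apply: eq_measurable_fun (mfun _ (mbpos l)).
  move=> x _; congr f; congr pair; apply/funext => k; by rewrite aE.
move=> k v; apply: measurableI => //; rewrite -[X in measurable X]setTI.
exact: (mfirst l k measurableT (measurable_hitn v mT' (mA l))).
Qed.

Lemma bmf_local_wret f l : continuous f ->
  (exists M : R, forall e, `|f e| <= M) -> bmf (local_obs wret f l).
Proof. exact: (@bmf_local wret T (fun l => c l)). Qed.

Lemma bmf_local_vret f l : continuous f ->
  (exists M : R, forall e, `|f e| <= M) -> bmf (local_obs vret f l).
Proof.
apply: (@bmf_local vret (firstret T Y) (fun l => c l / m)) => //.
exact: measurable_firstret.
Qed.

Lemma local_obs_bounded a f (M : R) l x : 0 <= M -> (forall e, `|f e| <= M) ->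
  `|local_obs a f l x| <= M.
Proof. by move=> M0 fM; rewrite /local_obs patchE; case: ifP; rewrite ?normr0. Qed.

(** If [T x] is outside [A l], the processes at [x] and [T x] differ only in the first return time,
    by [c l], and uniform continuity applies. The remaining points have measure [c l], and there the
    bound [2 * M] suffices. *)
Lemma local_obs_shift f e : continuous f ->
  (exists M : R, forall e, `|f e| <= M) -> 0 < e -> \forall l \near \oo,
  E (fun x => `|local_obs wret f l (T x) - local_obs wret f l x|) <= e.
Proof.
move=> cf fb e0; have [M' fM'] := fb.
have [M M0 fM] : exists2 M, 0 <= M & forall z, `|f z| <= M.
  by exists `|M'| => // z; rewrite (le_trans (fM' z))// ler_norm.
have e20 : 0 < e / 2 by rewrite divr_gt0.
have [n [r [r0 unif]]] := continuous_realpt_uniform cF cf e20.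
(* Chosen so that [2 * M * c l] is at most [e / 2]. *)
have e30 : 0 < e / (4 * (M + 1)) by rewrite divr_gt0// mulr_gt0// ltr_wpDl.
near=> l.
have cr : c l <= r by near: l; exact: c_small.
have ce : c l <= e / (4 * (M + 1)) by near: l; exact: c_small.
have bg := bmf_local_wret l cf fb.
have mTA : measurable (T @^-1` A l) by rewrite -[X in measurable X]setTI; exact: mT.
have b1 := bmf_indic (R := R) mTA.
apply: le_trans (_ : E (fun x => e / 2 + 2 * M * \1_(T @^-1` A l) x) <= _).
  apply: exp_le.
  - apply: bmf_norm; apply: bmfB => //; exact: bmf_comp.
  - by apply: bmfD (bmf_cst _) _; exact: bmfM (bmf_cst _) _.
  move=> x; rewrite indicE; have [/set_mem /= xA|/negP xA] := boolP (x \in _).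
    rewrite mulr1 -[leLHS]add0r lerD ?(ltW e20)//.
    rewrite (le_trans (ler_normB _ _))// mulr2n mulrDl mul1r.
    by rewrite lerD// local_obs_bounded.
  have nA : ~ A l (T x) by move=> Ax; apply: xA; exact: mem_set.
  rewrite mulr0 addr0 /local_obs !patchE.
  have -> : (T x \in H l) = (x \in H l).
    by rewrite -[in RHS](recurrent_preimage T (A l)).
  case: ifPn => [/set_mem Hx|_]; last by rewrite subrr normr0 ltW.
  have -> : (bpos l ^~ (T x)) = (bpos l ^~ x).
    by apply/funext => k; rewrite /bpos firstret_shift.
  apply: unif => [k|k|k _]; [exact: wret_ge0|exact: wret_ge0|].
  case: k => [|k]; last by rewrite /wret firstret_shift// subrr normr0 ltW.
  rewrite /wret /= (hitn_shift Hx nA) -mulrBr normrM -natr1 opprD addrA subrr add0r.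
  by rewrite normrN1 mulr1 ger0_norm// ltW.
rewrite expD; [|exact: bmf_cst|exact: bmfM (bmf_cst _) _].
rewrite exp_cst expZ// exp_indic//.
have -> : fine (mu (T @^-1` A l)) = c l by congr fine; exact: muT.2.
have M10 : 0 < M + 1 by rewrite ltr_wpDl.
have : 2 * M * c l <= 2 * (M + 1) * (e / (4 * (M + 1))).
  apply: ler_pM => //; [by rewrite mulr_ge0|exact: Pr_ge0|].
  by rewrite ler_pM2l// lerDl.
have -> : 2 * (M + 1) * (e / (4 * (M + 1))) = e / 2 by field; rewrite gt_eqF.
lra.
Unshelve. all: by end_near. Qed.

Lemma local_obs_mean f e : continuous f ->
  (exists M : R, forall e, `|f e| <= M) -> 0 < e -> \forall l \near \oo,
  `|E (fun x => local_obs wret f l x * \1_Y x) - m * E (local_obs wret f l)| <= e.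
Proof.
move=> cf fb; have [M fM] := fb.
apply: (asymptotic_mean (M' := `|M|) muT ergT) => //.
- by move=> l; exact: bmf_local_wret.
- move=> l x; apply: local_obs_bounded => // z.
  by rewrite (le_trans (fM z))// ler_norm.
- by move=> r r0; exact: local_obs_shift.
Qed.

(** Tightness on [Y] of each coordinate separately. The bound [M] is common to all large [l], while
    the exceptional set may vary with [l]. *)
Definition tight (a : nat -> nat -> X -> R) := forall k (r : R), 0 < r ->
  exists M : R, \forall l \near \oo, exists B : set X,
    [/\ measurable B, Pr mu B <= r &
        forall x, Y x -> H l x -> ~ B x -> a l k x <= M].

Lemma tight_finite a : tight a -> forall K (r : R), 0 < r ->
  exists2 M : R, 0 <= M & \forall l \near \oo, exists B : set X,
    [/\ measurable B, Pr mu B <= r &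
        forall x, Y x -> H l x -> ~ B x -> forall k, (k < K)%N -> a l k x <= M].
Proof.
move=> ta; elim=> [|K IH] r r0.
  by exists 0 => //; apply: nearW => l; exists set0; split=> //; rewrite /Pr measure0 ltW.
have r20 : 0 < r / 2 by rewrite divr_gt0.
have [M M0 IHM] := IH _ r20; have [N aN] := ta K _ r20.
exists (M + `|N|); first by rewrite addr_ge0.
apply: filterS2 IHM aN => l [B [mB PB aB]] [B' [mB' PB' aB']].
exists (B `|` B'); split; first exact: measurableU.
  by rewrite (le_trans (PrU _ _ _))// [r]splitr lerD.
move=> x Yx Hx /not_orP[nB nB'] k; rewrite ltnS leq_eqVlt => /orP[/eqP->|kK].
  by rewrite (le_trans (aB' _ _ _ _))// (le_trans (ler_norm _))// lerDr.
by rewrite (le_trans (aB _ _ _ _ _ kK))// lerDl.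
Qed.

Lemma sum_wret l K x : \sum_(k < K) wret l k x = c l * (hsum T (A l) K x)%:R.
Proof. by rewrite -mulr_sumr -natr_sum. Qed.

Lemma sum_vret l K x : H l x ->
  \sum_(k < K) vret l k x = c l / m * (visits T Y (hsum T (A l) K x) x)%:R.
Proof. by move=> Hx; rewrite -mulr_sumr -natr_sum sum_hitn_induced. Qed.

(** Off a small set the time [t] of the [k+1]-st visit is at most [2 / m] times its visit count plus
    a constant, so bounded sums of induced times bound the original ones. *)
Lemma tight_vret_wret : tight vret -> tight wret.
Proof.
move=> tv k r r0; have r20 : 0 < r / 2 by rewrite divr_gt0.
have [M M0 vM] := tight_finite tv k.+1 r20.
(* An error rate of [m / 2] leaves [m / 2 * t <= v + C] for the visit count [v] at time [t]. *)
have m20 : 0 < m / 2 by rewrite divr_gt0.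
have [C [B [mB PB visB]]] := visits_ergodic muT ergT mY m20 r20.
exists (2 * (k.+1%:R * M) + 2 * C%:R / m).
have c1 := c_small ltr01.
apply: filterS2 c1 vM => l c1 [B' [mB' PB' aB']].
exists (B `|` B'); split; first exact: measurableU.
  by rewrite (le_trans (PrU _ _ _))// [r]splitr lerD.
move=> x Yx Hx /not_orP[nB nB'].
have sv : \sum_(j < k.+1) vret l j x <= k.+1%:R * M.
  apply: le_trans (_ : \sum_(j < k.+1) M <= _); last first.
    by rewrite sumr_const card_ord mulr_natl.
  by apply: ler_sum => j _; exact: aB'.
have wk : wret l k x <= c l * (hsum T (A l) k.+1 x)%:R.
  by rewrite -sum_wret big_ord_recr/= lerDr sumr_ge0// => j _; exact: wret_ge0.
apply: le_trans wk _; move: sv; rewrite sum_vret//.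
have := visB x nB (hsum T (A l) k.+1 x).
set t := (hsum _ _ _ _)%:R; set v := (visits _ _ _ _)%:R.
rewrite ler_norml => /andP[h _] sv.
have h1 : m * t <= 2 * (v + C%:R) by move: h; lra.
have h2 : t <= 2 * v / m + 2 * C%:R / m.
  by rewrite -mulrDl ler_pdivlMr// mulrC -mulrDr.
apply: le_trans (ler_wpM2l (ltW (c0 l)) h2) _; rewrite mulrDr; apply: lerD.
  by rewrite (_ : c l * _ = 2 * (c l / m * v)) ?ler_pM2l//; ring.
by rewrite ler_piMl// divr_ge0// ltW.
Qed.

(** On a set where the scaled hitting times stay bounded, the ergodic estimate at these times makes
    corresponding partial sums of the two processes close; uniform continuity of [f] then compares
    its values. *)
Lemma tight_close f e : continuous f -> (exists M : R, forall e, `|f e| <= M) ->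
  tight wret -> 0 < e -> \forall l \near \oo,
  `|E (fun x => local_obs wret f l x * \1_Y x) -
    E (fun x => local_obs vret f l x * \1_Y x)| <= e.
Proof.
move=> cf fb tw e0; have [M' fM'] := fb.
have [Mf Mf0 fM] : exists2 M, 0 <= M & forall z, `|f z| <= M.
  by exists `|M'| => // z; rewrite (le_trans (fM' z))// ler_norm.
have e20 : 0 < e / 2 by rewrite divr_gt0.
have [n [r [r0 unif]]] := continuous_realpt_uniform cF cf e20.
have Mf10 : 0 < Mf + 1 by rewrite ltr_wpDl.
(* Two exceptional sets of measure [r1], on which the integrand is at most [2 * Mf], cost at most
   [e / 2]. *)
pose r1 := e / (8 * (Mf + 1)).
have r10 : 0 < r1 by rewrite divr_gt0// mulr_gt0.
have [M M0 wM] := tight_finite tw n r10.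
have nM0 : 0 <= n%:R * M by rewrite mulr_ge0.
have nM10 : 0 < n%:R * M + 1 by rewrite ltr_wpDl.
(* With scaled times at most [n * M], the linear error is at most [m * r / 4]; smallness of [c l]
   gives the same for [c l * C]. Division by [m] leaves [r / 2]. *)
pose e1 := m * r / (4 * (n%:R * M + 1)).
have e10 : 0 < e1 by rewrite divr_gt0 ?mulr_gt0.
have [C [B [mB PB visB]]] := visits_ergodic muT ergT mY e10 r10.
have C10 : 0 < C%:R + 1 :> R by rewrite ltr_wpDl.
have e40 : 0 < m * r / (4 * (C%:R + 1)) by rewrite divr_gt0 ?mulr_gt0.
apply: filterS2 (c_small e40) wM => l cl [B' [mB' PB' aB']].
have bw := bmf_local_wret l cf fb; have bv := bmf_local_vret l cf fb.
have b1Y := bmf_indic (R := R) mY.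
have mBB : measurable (B `|` B') by exact: measurableU.
have b1B := bmf_indic (R := R) mBB.
rewrite -expB; [|exact: bmfM|exact: bmfM].
apply: le_trans (exp_norm _ _) _; first by apply: bmfB; exact: bmfM.
apply: le_trans (_ : E (fun x => e / 2 + 2 * Mf * \1_(B `|` B') x) <= _); last first.
  rewrite expD; [|exact: bmf_cst|exact: bmfM (bmf_cst _) _].
  rewrite exp_cst expZ// exp_indic// -/(Pr mu _).
  have PBB : Pr mu (B `|` B') <= 2 * r1.
    by rewrite (le_trans (PrU _ _ _))// mulr2n mulrDl mul1r lerD.
  have : 2 * Mf * Pr mu (B `|` B') <= 2 * (Mf + 1) * (2 * r1).
    apply: ler_pM => //; [by rewrite mulr_ge0|exact: Pr_ge0|].
    by rewrite ler_pM2l// lerDl.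
  have -> : 2 * (Mf + 1) * (2 * r1) = e / 2 by rewrite /r1; field; rewrite gt_eqF.
  lra.
apply: exp_le; first by apply/bmf_norm/bmfB; exact: bmfM.
  by apply: bmfD (bmf_cst _) _; exact: bmfM (bmf_cst _) _.
move=> x; rewrite -mulrBl normrM.
have ind1 : `|\1_Y x : R| <= 1 by rewrite indicE; case: (_ \in _); rewrite ?normr1 ?normr0.
have [/set_mem xBB|/negP xBB] := boolP (x \in B `|` B').
  rewrite [X in _ <= _ + _ * X]indicE (mem_set xBB) mulr1.
  apply: le_trans (_ : 2 * Mf <= _); last by rewrite lerDr ltW.
  rewrite -[leRHS]mulr1 ler_pM// (le_trans (ler_normB _ _))// mulr2n mulrDl mul1r.
  by rewrite lerD// local_obs_bounded.
rewrite [X in _ <= _ + _ * X]indicE (negbTE (introN idP xBB)) mulr0 addr0.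
have [/set_mem Yx|nY] := boolP (x \in Y); last first.
  by rewrite indicE (negbTE nY) normr0 mulr0 ltW.
have [Hx|nH] := boolP (x \in H l); last first.
  by rewrite /local_obs !patchE (negbTE nH) subrr normr0 mul0r ltW.
rewrite /local_obs !patchE Hx -[leRHS]mulr1 ler_pM//.
move: Hx => /set_mem Hx.
have /not_orP[nB nB'] : ~ (B x \/ B' x) by move=> h; apply: xBB; exact: mem_set.
pose t j := \sum_(k < j) wret l k x; pose s j := \sum_(k < j) vret l k x.
have ts j : (j <= n)%N -> `|t j - s j| <= r / 2.
  move=> jn; rewrite /t /s sum_wret sum_vret//.
  have tM : c l * (hsum T (A l) j x)%:R <= n%:R * M.
    rewrite -sum_wret; apply: le_trans (_ : \sum_(k < j) M <= _).
      by apply: ler_sum => k _; apply: aB' => //; exact: leq_trans jn.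
    by rewrite sumr_const card_ord -[M *+ j]mulr_natl ler_wpM2r// ler_nat.
  have := visB x nB (hsum T (A l) j x).
  move: tM; set u := (hsum _ _ _ _)%:R; set v := (visits _ _ _ _)%:R => tM hv.
  rewrite (_ : c l * u - c l / m * v = - (c l / m * (v - m * u))); last first.
    by field; rewrite gt_eqF.
  have cm0 : 0 <= c l / m by rewrite divr_ge0// ltW.
  rewrite normrN normrM (ger0_norm cm0).
  apply: le_trans (ler_wpM2l cm0 hv) _.
  have -> : c l / m * (e1 * u + C%:R) = (e1 * (c l * u) + c l * C%:R) / m by ring.
  rewrite ler_pdivrMr//.
  have h1 : e1 * (c l * u) <= m * r / 4.
    apply: le_trans (_ : e1 * (n%:R * M + 1) <= _).
      by rewrite ler_pM2l// (le_trans tM)// lerDl.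
    by rewrite le_eqVlt; apply/orP; left; apply/eqP; rewrite /e1; field; rewrite gt_eqF.
  have h2 : c l * C%:R <= m * r / 4.
    apply: le_trans (_ : m * r / (4 * (C%:R + 1)) * (C%:R + 1) <= _).
      by apply: ler_pM => //; rewrite ?lerDl// ltW.
    by rewrite le_eqVlt; apply/orP; left; apply/eqP; field; rewrite gt_eqF.
  lra.
apply: unif => [k|k|k kn]; [exact: wret_ge0|exact: vret_ge0|].
(* A single coordinate is the difference of two consecutive partial sums, hence the error [r / 2]
   twice. *)
have -> : wret l k x - vret l k x = (t k.+1 - s k.+1) - (t k - s k).
  by rewrite /t /s !big_ord_recr/=; ring.
by rewrite (le_trans (ler_normB _ _))// [r]splitr lerD// ts// ltnW.
Qed.

(** The complement of [H l] is null, so the values of [Z] there, possibly infinite, do not influence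
    the mean. *)
Lemma mean_on_local D (a : nat -> nat -> X -> R) (Z : X -> Espace R F) f l :
  (forall x, H l x -> Z x = realpt (a l ^~ x) (bpos l ^~ x)) ->
  mean_on mu D (f \o Z) = (Pr mu D)^-1 * E (fun x => local_obs a f l x * \1_D x).
Proof.
move=> ZE; rewrite /mean_on; congr (_ * _).
rewrite exp_setI -(Rintegral_setI_full D _ (mH l) (muH l)) Rintegral_mkcondr.
apply: eq_Rintegral => x _; rewrite /local_obs !patchE.
by case: ifP => // /set_mem Hx /=; rewrite ZE.
Qed.

(** Finiteness of [Phi] makes large values of its [k]-th entry improbable, so the escape test has
    small mean in the limit and hence for large [l]. Markov's inequality then bounds the set where
    [a l k] is large. *)
Lemma cvg_law_tight (dO : measure_display) (Om : measurableType dO)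
    (P : probability Om R) (Phi : Om -> nat -> R) (Psi : Om -> nat -> F)
    (a : nat -> nat -> X -> R) (Z : nat -> X -> Espace R F) :
  (forall w k, 0 <= Phi w k) ->
  (forall k, measurable_fun setT (fun w => Phi w k)) ->
  (forall l x, H l x -> Z l x = realpt (a l ^~ x) (bpos l ^~ x)) ->
  (forall l k x, 0 <= a l k x) ->
  (forall f l, continuous f -> (exists M : R, forall e, `|f e| <= M) ->
    bmf (local_obs a f l)) ->
  cvg_law mu Y Z P (fun w => realpt (Phi w) (Psi w)) -> tight a.
Proof.
move=> Phi0 mPhi ZE a0 ba cvgZ k r r0.
(* The limit mean is at most [2 * (r / 8)]; adding the convergence error [r / 4] gives [r / 2], and
   Markov at level [1 / 2] doubles this to [r]. *)
have r80 : 0 < r / 8 by rewrite divr_gt0.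
have r40 : 0 < r / 4 by rewrite divr_gt0.
have mB n : measurable [set w | n%:R < Phi w k] by exact: measurable_gt.
have [j Pj] : exists j : nat, Pr P [set w | j%:R < Phi w k] <= r / 8.
  apply: (Pr_nonincreasing_small mB) => //.
    by move=> n w /=; apply: lt_trans; rewrite ltr_nat.
  rewrite (_ : bigcap _ _ = set0) /Pr ?measure0//.
  apply/seteqP; split=> // w /(_ (Num.bound (Phi w k)) I) /=.
  by rewrite ltNge ltW// archi_boundP.
have cf : continuous (escape_test k j.+1 : Espace R F -> R) by exact: escape_test_continuous.
have bf : exists M : R, forall e, `|escape_test k j.+1 (e : Espace R F)| <= M.
  exact: escape_test_bounded.
have Lr : mean_on P setT (escape_test k j.+1 \o (fun w => realpt (Phi w) (Psi w))) <= r / 4.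
  rewrite /mean_on (_ : fine _ = 1); last first.
    by rewrite -[1]/(fine 1%:E) -(probability_setT P).
  rewrite invr1 mul1r.
  apply: le_trans (_ : Rintegral P setT (fun w => 2 * \1_[set w | j%:R < Phi w k] w) <= _).
    have b1 := bmf_indic (R := R) (mB j).
    apply: exp_le; [|exact: bmfM (bmf_cst _) _|].
      split; last by have [M fM] := bf; exists M => w; exact: fM.
      exact: measurable_escape_test.
    move=> w /=; rewrite indicE; case: (boolP (w \in _)) => [_|].
      by rewrite mulr1 escape_test_le2.
    rewrite notin_setE /= => /negP; rewrite -leNgt => Phij.
    by rewrite mulr0 escape_test_small.
  rewrite expZ ?exp_indic//; last exact: bmf_indic.
  by move: Pj; rewrite /Pr; lra.
exists (2 * j.+1%:R).
have /cvgrPdist_le/(_ _ r40) := cvgZ _ cf bf.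
apply: filterS => l; rewrite (mean_on_local _ _ (ZE l)) => dist.
pose g x := local_obs a (escape_test k j.+1) l x * \1_Y x.
have bY := bmf_indic (R := R) mY.
have bg : bmf g by apply: bmfM => //; exact: ba.
have g0 x : 0 <= g x.
  rewrite /g mulr_ge0 ?indicE// /local_obs patchE.
  by case: ifP => // _; exact: escape_test_ge0.
have Er : E g <= r / 2.
  have : m^-1 * E g <= r / 2 by move: dist Lr; rewrite ler_norml => /andP[]; lra.
  rewrite mulrC ler_pdivrMr// => /le_trans; apply.
  rewrite ler_piMr ?divr_ge0 ?(ltW r0)// Pr_exp// -[leRHS](exp_cst mu).
  by apply: exp_le => //; exact: bmf_cst.
have mBg : measurable [set x | 1 / 2 < g x] by apply: measurable_gt; exact: bg.1.
exists [set x | 1 / 2 < g x]; split=> //.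
  rewrite Pr_exp//; apply: le_trans (_ : E (fun x => 2 * g x) <= _).
    apply: exp_le; [exact: bmf_indic|exact: bmfM (bmf_cst _) _|].
    move=> x; rewrite indicE; case: (boolP (x \in _)) => [/set_mem /= gx|_].
      by move: gx; lra.
    by rewrite mulr_ge0.
  by rewrite expZ//; lra.
move=> x Yx Hx /negP; rewrite -leNgt; apply: contraTT; rewrite -!ltNge => ak.
rewrite /g indicE (mem_set Yx) mulr1 /local_obs patchE (mem_set Hx).
apply: lt_le_trans (escape_test_large _ _ ak) => //.
lra.
Qed.

(** Dividing [local_obs_mean] by [m] shows that the means under [mu] and [mu_Y] have vanishing
    difference for every test function. *)
Lemma cvg_law_restrict (Z : nat -> X -> Espace R F) (dO : measure_display)
    (Om : measurableType dO) (P : probability Om R) (Zinf : Om -> Espace R F) :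
  (forall l x, H l x -> Z l x = realpt (wret l ^~ x) (bpos l ^~ x)) ->
  cvg_law mu setT Z P Zinf <-> cvg_law mu Y Z P Zinf.
Proof.
move=> ZE; have equiv f : continuous f -> (exists M : R, forall e, `|f e| <= M) ->
    (fun l => mean_on mu setT (f \o Z l)) @ \oo --> mean_on P setT (f \o Zinf) <->
    (fun l => mean_on mu Y (f \o Z l)) @ \oo --> mean_on P setT (f \o Zinf).
  move=> cf fb; apply: cvg_close_iff => e e0.
  have em0 : 0 < e * m by rewrite mulr_gt0.
  apply: filterS (local_obs_mean cf fb em0) => l.
  rewrite (mean_on_local _ _ (ZE l)) (mean_on_local _ _ (ZE l)).
  have -> : Pr mu setT = 1 by rewrite /Pr probability_setT.
  under [X in (1^-1 * Rintegral _ _ X)]eq_fun do rewrite indicT mulr1.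
  rewrite invr1 mul1r => h.
  rewrite (_ : _ - _ = - (m^-1 * (E (fun x => local_obs wret f l x * \1_Y x) -
     m * E (local_obs wret f l)))); last by field; rewrite gt_eqF.
  by rewrite normrN normrM gtr0_norm ?invr_gt0// mulrC ler_pdivrMr.
by split=> h f cf fb; apply/equiv => //; exact: h.
Qed.

Lemma cvg_law_induced (Z Z' : nat -> X -> Espace R F) (dO : measure_display)
    (Om : measurableType dO) (P : probability Om R) (Zinf : Om -> Espace R F) :
  (forall l x, H l x -> Z l x = realpt (wret l ^~ x) (bpos l ^~ x)) ->
  (forall l x, H l x -> Z' l x = realpt (vret l ^~ x) (bpos l ^~ x)) ->
  tight wret -> cvg_law mu Y Z P Zinf <-> cvg_law mu Y Z' P Zinf.
Proof.
move=> ZE Z'E tw; have equiv f : continuous f -> (exists M : R, forall e, `|f e| <= M) ->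
    (fun l => mean_on mu Y (f \o Z l)) @ \oo --> mean_on P setT (f \o Zinf) <->
    (fun l => mean_on mu Y (f \o Z' l)) @ \oo --> mean_on P setT (f \o Zinf).
  move=> cf fb; apply: cvg_close_iff => e e0.
  have em0 : 0 < e * m by rewrite mulr_gt0.
  apply: filterS (tight_close cf fb tw em0) => l.
  rewrite (mean_on_local _ _ (ZE l)) (mean_on_local _ _ (Z'E l)) => h.
  by rewrite -mulrBr normrM gtr0_norm ?invr_gt0// mulrC ler_pdivrMr.
by split=> h f cf fb; apply/equiv => //; exact: h.
Qed.

End return_processes.

(** * The equivalence of the two convergences in law *)

Unset Implicit Arguments.
Set Strict Implicit.

Theorem mainTheorem17
  (R : realType) (d : measure_display) (X : measurableType d)
  (mu : probability X R) (T : X -> X)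
  (F : metricType R)
  (Y : set X) (A : nat -> set X) (psi : nat -> X -> F)
  (dO : measure_display) (Om : measurableType dO) (P : probability Om R)
  (Phi : Om -> nat -> R) (Psi : Om -> nat -> F) :
  compact [set: F] ->
  measure_preserving mu T -> ergodic mu T ->
  measurable Y -> (0 < mu Y)%E ->
  (forall l, measurable (A l)) -> (forall l, A l `<=` Y) ->
  (forall l, (0 < mu (A l))%E) -> (mu \o A) @ \oo --> 0%E ->
  (forall l, borel_measurable_on (A l) (psi l)) ->
  (forall w n, 0 <= Phi w n) ->
  (forall n, measurable_fun setT (fun w => Phi w n)) ->
  (forall n, borel_measurable_on setT (fun w => Psi w n)) ->
  let Zinf := fun w : Om =>
    ((fun n => (Phi w n)%:E) : {ptws nat -> \bar R}, Psi w : {ptws nat -> F}) in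
  cvg_law mu setT
    (fun l x =>
       ((fun n => mu (A l) * Phiseq (phi T (A l)) T (A l) x n)%E
          : {ptws nat -> \bar R},
        Psiseq (psi l) T (A l) x : {ptws nat -> F}) : Espace R F)
    P Zinf
  <->
  cvg_law mu Y
    (fun l x =>
       ((fun n => (fine (mu (Y `&` A l)) / fine (mu Y))%:E *
                  Phiseq (phi (firstret T Y) (A l)) T (A l) x n)%E
          : {ptws nat -> \bar R},
        Psiseq (psi l) T (A l) x : {ptws nat -> F}) : Espace R F)
    P Zinf.
Proof.
move=> cF muT ergT mY muY mA AY muA rareA mpsi Phi0 mPhi mPsi Zinf.
have ZWE l x : recurrent T (A l) x ->
  ((fun n => mu (A l) * Phiseq (phi T (A l)) T (A l) x n)%E : {ptws nat -> \bar R},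
   Psiseq (psi l) T (A l) x : {ptws nat -> F}) =
  realpt (wret mu T A l ^~ x) (bpos T A psi l ^~ x).
  move=> Hx; congr pair; apply/funext => k.
  by rewrite /Phiseq phi_hitn ?PrE//; exact/recurrent_hits/recurrent_firstret.
have ZVE l x : recurrent T (A l) x ->
  ((fun n => (fine (mu (Y `&` A l)) / fine (mu Y))%:E *
             Phiseq (phi (firstret T Y) (A l)) T (A l) x n)%E : {ptws nat -> \bar R},
   Psiseq (psi l) T (A l) x : {ptws nat -> F}) =
  realpt (vret mu T Y A l ^~ x) (bpos T A psi l ^~ x).
  move=> Hx; congr pair; apply/funext => k.
  have [hy _] := hitn_induced (AY l) (recurrent_firstret k Hx).
  (* Since [A l] lies in [Y], its conditional measure is [c l / m], the scale in [vret]. *)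
  by rewrite /Phiseq phi_hitn// (setIidr (AY l)).
have tW : cvg_law mu Y _ P Zinf -> tight mu T Y A (wret mu T A) :=
  cvg_law_tight muT ergT mY muY mA muA Phi0 mPhi ZWE
    (wret_ge0 mu T A) (fun f l => bmf_local_wret cF muT mA mpsi l).
have tV : cvg_law mu Y _ P Zinf -> tight mu T Y A (vret mu T Y A) :=
  cvg_law_tight muT ergT mY muY mA muA Phi0 mPhi ZVE
    (vret_ge0 mu T Y A) (fun f l => bmf_local_vret cF muT mY mA mpsi l).
(* Both directions pass through the law of the original process under [mu_Y]. Here tightness of
   [wret] comes directly from convergence of that law. *)
split=> [/(cvg_law_restrict cF muT ergT mY muY mA muA rareA mpsi _ _ ZWE) h|h].
  by apply/(cvg_law_induced cF muT ergT mY muY mA AY muA rareA mpsi _ _ ZWE ZVE (tW h)).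
apply/(cvg_law_restrict cF muT ergT mY muY mA muA rareA mpsi _ _ ZWE).
apply/(cvg_law_induced cF muT ergT mY muY mA AY muA rareA mpsi _ _ ZWE ZVE) => //.
(* Only the induced process is known to converge in this direction, so its tightness is transferred
   to [wret]. *)
exact: (tight_vret_wret muT ergT mY muY mA AY muA rareA (tV h)).
Qed.
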